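(* Suppose $S\in\mathbb R^{d\times d}$ is nonnegative and irreducible, and the solution $m(z)$ of the Dyson equation is uniformly bounded on $\overline{\mathbb C_+}(I)$, where $I=[\alpha_0,\beta_0]\subset\mathbb R$ is a closed interval. Then: 1. On $I$ each measure $\tilde v_i$ has a Lebesgue density, that is, $\tilde v_i(\mathrm d\tau)=v_i(\tau)\,\mathrm d\tau$ for $\tau\in I$. The densities of all components are comparable: for every $1\le i<j\le d$, $v_i(\tau)\sim v_j(\tau)$ for $\tau\in I$. 2. There is a finite exponent $\alpha>0$, depending only on model parameters, such that the densities are uniformly $\alpha$-Hölder continuous: for every $1\le i\le d$, $$|v_i(\tau_2)-v_i(\tau_1)|\lesssim|\tau_2-\tau_1|^\alpha,\qquad \tau_1,\tau_2\in I.$$ 3. Each $m_i$ is uniformly $\alpha$-Hölder continuous: for every $1\le i\le d$, $$|m_i(z_1)-m_i(z_2)|\lesssim|z_1-z_2|^\alpha,\qquad z_1,z_2\in\overline{\mathbb C_+}(I).$$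
   Context: $\mathbb C_+=\{z\in\mathbb C:\operatorname{Im}z>0\}$. Let $d\ge1$, $S=(s_{ij})\in\mathbb R^{d\times d}$ entrywise nonnegative, $\mathbf a=(a_i)\in\mathbb R^d$. $S$ is irreducible if for all $i,j$ there is $n\ge1$ with $(S^n)_{ij}>0$. For each $z\in\mathbb C_+$, $m(z)=(m_1(z),\dots,m_d(z))\in\mathbb C_+^d$ denotes the unique solution in $\mathbb C_+^d$ of the Dyson equation $-\frac1{m_i(z)}=z-a_i+\sum_{j=1}^d s_{ij}m_j(z)$, $i=1,\dots,d$. For each $i$, $\tilde v_i$ is the unique (compactly supported) probability measure on $\mathbb R$ with $m_i(z)=\int_{\mathbb R}\frac{\tilde v_i(\mathrm d\tau)}{\tau-z}$, $z\in\mathbb C_+$. The density $v_i$ is normalized pointwise by $$v_i(\tau)=\frac1\pi\lim_{\eta\downarrow0}\operatorname{Im}\Big(m_i(\tau+\mathrm i\eta)-\sum_k\frac{\Delta_{i,k}}{\tau_{i,k}-(\tau+\mathrm i\eta)}\Big),$$ where $\tau_{i,k}$ are the (finitely many) atoms of $\tilde v_i$ and $\Delta_{i,k}$ their masses. For a closed interval $I$, $\mathbb C_+(I):=\{z\in\mathbb C_+:\operatorname{Re}z\in I\}$ and $\overline{\mathbb C_+}(I):=\{z:\operatorname{Re}z\in I,\ \operatorname{Im}z\ge0\}$. If $|m(z)|_2\le\Phi_I<\infty$ on $\mathbb C_+(I)$, then $m$ extends uniquely and continuously to $\overline{\mathbb C_+}(I)$ and $m$ denotes this extension; ''uniformly bounded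 on $\overline{\mathbb C_+}(I)$'' means that such a $\Phi_I$ exists. $f\lesssim g$ means $f\le Cg$ and $f\sim g$ means $f\lesssim g\lesssim f$, with finite positive constants depending only on absolute constants and the fixed model parameters (the data $d,S,\mathbf a,I$ and the bound $\Phi_I$), in particular not on $z,\tau$. *)

(* Defs.v *)
From HB Require Import structures.
From mathcomp Require Export all_boot all_order all_algebra.
From mathcomp Require Export all_classical all_reals all_analysis.
From mathcomp Require Export complex.

Set Implicit Arguments.
Unset Strict Implicit.
Unset Printing Implicit Defensive.

Export Order.TTheory GRing.Theory Num.Theory numFieldNormedType.Exports.

Local Open Scope classical_set_scope.
Local Open Scope ring_scope.
Local Open Scope complex_scope.

(* The norm of the numeric field R[i] takes its values in R[i] itself (as
   nonnegative reals); cabs is the same quantity read in R. *)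
Definition cabs (R : realType) (z : R[i]) : R := complex.Re `|z|.

Definition euclid_norm (R : realType) (d : nat) (u : 'cV[R[i]]_d) : R :=
  Num.sqrt (\sum_i cabs (u i 0) ^+ 2).

Definition entrywise_nonneg (R : realType) (d : nat) (S : 'M[R]_d) : Prop :=
  forall i j, 0 <= S i j.

Definition irreducible_mx (R : realType) (d : nat) (S : 'M[R]_d) : Prop :=
  forall i j, exists2 n : nat, (1 <= n)%N & 0 < (S ^+ n) i j.

Definition Cplus (R : realType) : set R[i] :=
  [set z | 0 < complex.Im z].

Definition Cplus_over (R : realType) (I : set R) : set R[i] :=
  [set z | I (complex.Re z) /\ 0 < complex.Im z].

Definition clCplus_over (R : realType) (I : set R) : set R[i] :=
  [set z | I (complex.Re z) /\ 0 <= complex.Im z].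

Definition dyson_solution (R : realType) (d : nat) (S : 'M[R]_d)
    (a : 'cV[R]_d) (z : R[i]) (u : 'cV[R[i]]_d) : Prop :=
  forall i, Cplus (u i 0) /\
    - (1 / u i 0) = z - (a i 0)%:C + \sum_j (S i j)%:C * u j 0.

Definition stieltjes (R : realType) (nu : probability (measurableTypeR R) R)
    (z : R[i]) : R[i] :=
  (\int[nu]_t complex.Re (1 / (t%:C - z)))
    +i* (\int[nu]_t complex.Im (1 / (t%:C - z))).

Definition atoms (R : realType) (nu : probability (measurableTypeR R) R) :
    set R :=
  [set t | nu [set t] != 0%E].

(* Pointwise normalization of the density of nu, f being its Stieltjes
   transform: the sum is over the
   (finitely many) atoms of nu, and eta decreases to 0. *)
Definition density (R : realType) (nu : probability (measurableTypeR R) R)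
    (f : R[i] -> R[i]) (tau : R) : R :=
  pi^-1 * lim (complex.Im (f (tau +i* eta) -
    \sum_(t \in atoms nu) ((fine (nu [set t]))%:C / (t%:C - (tau +i* eta))))
      @[eta --> 0^'+]).

Definition has_density_on (R : realType)
    (nu : probability (measurableTypeR R) R) (I : set R) (v : R -> R) : Prop :=
  [/\ measurable_fun (I : set (measurableTypeR R)) v,
      (forall x, I x -> 0 <= v x) &
      forall A : set (measurableTypeR R), measurable A -> A `<=` I ->
        nu A = (\int[lebesgue_measure]_(x in A) (v x)%:E)%E].

(* Extension of f from the open strip Cplus_over I to clCplus_over I: on the
   real axis, the limit along the open strip. R[i]^o carries the norm
   topology of the complex plane, which R[i] lacks. *)
Definition extension (R : realType) (I : set R) (f : R[i] -> R[i])
    (z : R[i]) : R[i] :=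
  if 0 < complex.Im z then f z
  else lim ((f w : R[i]^o) @[w --> within (Cplus_over I) (nbhs (z : R[i]^o))]).

(* Main.v *)
(* The solution map is locally Lipschitz in the upper half plane and the
   linearisation of the Dyson system at a solution is injective: both follow from
   weighing the components with their imaginary parts, for which
   [Im m_i = |m_i|^2 (Im z + sum_j s_ij Im m_j)] is a contraction estimate.
   Each component is an algebraic function of [z]: adding [t m_i^3] to the i-th
   equation gives a system whose quotient algebra is finite over the powers of [t],
   hence a characteristic polynomial killing [m_i], and injectivity of the
   linearisation provides formal solutions in [t] through every solution at [t = 0];
   the lowest order coefficient in [t] yields a polynomial relation [P (z, m_i) = 0].
   After dividing [P] by the gcd of its coefficients, [P (z, _)] is bounded away from
   [0] as a polynomial. If [m_i] moved by [D] along a segment of length [e], then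
   [P (z, _)], of degree at most [n], would be [O (e)] at [n + 1] points at mutual
   distance at least [D / n], so that [D^n = O (e)]: this is Hoelder continuity with
   exponent [1 / n]. The boundary values then give the density by Stieltjes
   inversion, and comparability of the densities follows from irreducibility. *)
Require Import Defs.
From HB Require Import structures.
From mathcomp Require Import measurable_realfun ring lra zify.

Set Implicit Arguments.
Unset Strict Implicit.
Unset Printing Implicit Defensive.

Local Open Scope classical_set_scope.
Local Open Scope ring_scope.
Local Open Scope complex_scope.

(** * Algebraicity of the solution *)

(** The Dyson equation multiplied by its unknown, with [b i] standing for $z-a_i$. The ring is
    arbitrary because the unknowns are scalars first and polynomials in the deformation parameter
    later. *)
Definition dyson_form (A : comNzRingType) (d : nat) (s : 'I_d -> 'I_d -> A)
    (b x : 'I_d -> A) (i : 'I_d) : A :=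
  x i * (b i + \sum_j s i j * x j) + 1.

(** The derivative of [dyson_form] at [x] in the direction [y]. *)
Definition dyson_jacobian (A : comNzRingType) (d : nat)
    (s : 'I_d -> 'I_d -> A) (b x y : 'I_d -> A) (i : 'I_d) : A :=
  y i * (b i + \sum_j s i j * x j) + x i * \sum_j s i j * y j.

(* The cubic terms make the system a complete intersection at infinity, whatever
   the zeros of [s] are. *)
Definition cubic_dyson (F : fieldType) (d : nat) (s : 'I_d -> 'I_d -> F)
    (b : 'I_d -> F) (x : 'I_d -> {poly F}) (i : 'I_d) : {poly F} :=
  dyson_form (fun i j => (s i j)%:P) (fun i => (b i)%:P) x i + 'X * x i ^+ 3.

(** Newton step: when [e] is a positive power of the deformation parameter ['X], every correction
    other than the Jacobian term carries an additional factor ['X]. *)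
Lemma cubic_dyson_expand (F : fieldType) (d : nat) (s : 'I_d -> 'I_d -> F)
    (b : 'I_d -> F) (x y : 'I_d -> {poly F}) (e : {poly F}) (i : 'I_d) :
  exists r : {poly F}, cubic_dyson s b (fun j => x j + e * y j) i =
    cubic_dyson s b x i
    + e * dyson_jacobian (fun i j => (s i j)%:P) (fun i => (b i)%:P) x y i
    + e * (e * r + 'X * (3 * x i ^+ 2 * y i)).
Proof.
exists (y i * \sum_j (s i j)%:P * y j + 'X * (3 * x i * y i ^+ 2 + e * y i ^+ 3)).
rewrite /cubic_dyson /dyson_form /dyson_jacobian.
have -> : \sum_j (s i j)%:P * (x j + e * y j) =
    \sum_j (s i j)%:P * x j + e * \sum_j (s i j)%:P * y j.
  by rewrite mulr_sumr -big_split /=; apply: eq_bigr => j _; ring.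
by ring.
Qed.

Lemma dyson_jacobian_surj (F : fieldType) (d : nat) (s : 'I_d -> 'I_d -> F)
    (b m : 'I_d -> F) :
  (forall y, (forall i, dyson_jacobian s b m y i = 0) -> forall i, y i = 0) ->
  forall c, exists y, forall i, dyson_jacobian s b m y i = c i.
Proof.
move=> inj c.
pose J : 'M[F]_d := \matrix_(j, i)
  ((if j == i then b i + \sum_k s i k * m k else 0) + m i * s i j).
have JE (y : 'rV[F]_d) i : (y *m J) 0 i = dyson_jacobian s b m (fun j => y 0 j) i.
  rewrite mxE /dyson_jacobian; set T := b i + _.
  under eq_bigr => j _ do rewrite mxE -/T mulrDr.
  rewrite big_split /=; congr (_ + _).
    rewrite (bigD1 i) //= eqxx big1 ?addr0 // => j /negbTE ->.
    by rewrite mulr0.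
  by rewrite mulr_sumr; apply: eq_bigr => j _; ring.
have Ju : J \in unitmx.
  rewrite -row_free_unit; apply/inj_row_free => v v0.
  by apply/rowP => i; rewrite mxE (inj (fun j => v 0 j)) // => j; rewrite -JE v0 mxE.
exists (fun j => ((\row_i c i) *m invmx J) 0 j) => i.
by rewrite -JE mulmxKV // mxE.
Qed.

(** Formal Newton iteration: if the residual is $rX^{K+1}$, a correction $yX^{K+1}$ with Jacobian
    value $-r(0)$ removes its lowest coefficient. The induction starts at order one, so that
    corrections leave the value at 0 unchanged. *)
Lemma cubic_dyson_lift (F : fieldType) (d : nat) (s : 'I_d -> 'I_d -> F)
    (b m : 'I_d -> F) :
  (forall y, (forall i, dyson_jacobian s b m y i = 0) -> forall i, y i = 0) ->
  (forall i, dyson_form s b m i = 0) ->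
  forall K, exists x : 'I_d -> {poly F}, (forall i, (x i).[0] = m i) /\
    forall i, 'X^K %| cubic_dyson s b x i.
Proof.
move=> inj sol; case=> [|K].
  exists (fun i => (m i)%:P); split=> [i|i]; first by rewrite hornerC.
  by rewrite expr0 dvd1p.
elim: K => [|K [x [x0 xK]]].
  exists (fun i => (m i)%:P); split=> [i|i]; first by rewrite hornerC.
  rewrite expr1 /cubic_dyson dvdp_addl ?dvdp_mulr //.
  have -> : dyson_form (fun i j => (s i j)%:P) (fun i => (b i)%:P)
      (fun i => (m i)%:P) i = (dyson_form s b m i)%:P.
    rewrite /dyson_form !(polyCD, polyCM) rmorph_sum /=; congr (_ * (_ + _) + _).
    by apply: eq_bigr => j _; rewrite polyCM.
  by rewrite sol dvdp0.
have /all_sig [r rE] i : {r : {poly F} | cubic_dyson s b x i = r * 'X^(K.+1)}.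
  by exists (cubic_dyson s b x i %/ 'X^(K.+1)); rewrite divpK.
have [y yE] := dyson_jacobian_surj inj (fun i => - (r i).[0]).
exists (fun j => x j + 'X^(K.+1) * (y j)%:P); split=> i.
  by rewrite !hornerE expr0n /= mul0r addr0 x0.
have [t ->] := cubic_dyson_expand s b x (fun j => (y j)%:P) 'X^(K.+1) i.
rewrite rE [r i * _]mulrC -!mulrDr exprSr dvdp_mul2l ?expf_neq0 ?polyX_eq0 //.
rewrite -[X in X %| _]subr0 -(polyC0 F) -root_factor_theorem; apply/rootP.
have jac0 : (dyson_jacobian (fun i j => (s i j)%:P) (fun i => (b i)%:P) x
    (fun j => (y j)%:P) i).[0] = dyson_jacobian s b m y i.
  rewrite /dyson_jacobian !hornerE !horner_sum x0; congr (_ * (_ + _) + _ * _).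
    by apply: eq_bigr => j _; rewrite !hornerE x0.
  by apply: eq_bigr => j _; rewrite !hornerE.
rewrite hornerD hornerD jac0 yE subrr add0r.
by rewrite !hornerE expr0n /= !(mul0r, addr0).
Qed.

(** * Monomials and elimination in the deformed system *)

Definition word_mono (A : comNzRingType) (d : nat) (x : 'I_d -> A)
    (w : seq 'I_d) : A := \prod_(i <- w) x i.

(** The monomials with all exponents at most 2: a finite family that spans, up to powers of the
    parameter, all polynomials in the unknowns modulo the deformed system. *)
Definition exp_mono (A : comNzRingType) (d : nat) (x : 'I_d -> A)
    (e : {ffun 'I_d -> 'I_3}) : A := \prod_i x i ^+ e i.

Lemma word_monoE (A : comNzRingType) (d : nat) (x : 'I_d -> A) (w : seq 'I_d) :
  word_mono x w = \prod_i x i ^+ count_mem i w.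
Proof.
elim: w => [|j w IH]; first by rewrite /word_mono big_nil big1.
rewrite /word_mono big_cons -/(word_mono x w) IH /=.
rewrite [in RHS](bigD1 j) //= eqxx exprS -mulrA [in LHS](bigD1 j) //=.
by congr (_ * (_ * _)); apply: eq_bigr => i /negbTE ij; rewrite eq_sym ij.
Qed.

Section Elimination.
Variables (F : fieldType) (d : nat) (s : 'I_d -> 'I_d -> F) (a : 'I_d -> F).

(** In [{poly {poly F}}] the outer variable is the deformation parameter and the inner one is the
    spectral variable, which [evz z] specialises to [z]. *)
Notation evz z := (map_poly (horner_eval z)).

Let approx K z (x : 'I_d -> {poly F}) :=
  forall i, 'X^K %| cubic_dyson s (fun i => z - a i) x i.

(* [f] reduces, up to a power of the deformation parameter, to monomials with
   exponents at most 2, with coefficients polynomial in [z] and the parameter. *)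
Definition reducible_at (f : F -> ('I_d -> {poly F}) -> {poly F}) (N : nat)
    (c : {ffun 'I_d -> 'I_3} -> {poly {poly F}}) : Prop :=
  forall K z x, approx K z x ->
    'X^K %| 'X^N * f z x - \sum_e evz z (c e) * exp_mono x e.

Definition reducible f := exists N c, reducible_at f N c.

Lemma reducible_at_shift f N M c :
  reducible_at f N c -> reducible_at f (M + N) (fun e => 'X^M * c e).
Proof.
move=> fc K z x /fc h.
have -> : 'X^(M + N) * f z x - \sum_e evz z ('X^M * c e) * exp_mono x e =
   'X^M * ('X^N * f z x - \sum_e evz z (c e) * exp_mono x e).
  rewrite exprD mulrBr mulrA mulr_sumr; congr (_ - _).
  by apply: eq_bigr => e _; rewrite rmorphM /= map_polyXn mulrA.
exact: dvdp_mull.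
Qed.

Lemma reducible_basis e : reducible (fun _ x => exp_mono x e).
Proof.
exists 0%N, (fun e' => (e' == e)%:R) => K z x _.
rewrite expr0 mul1r (bigD1 e) //= eqxx rmorph1 mul1r big1 ?addr0 ?subrr ?dvdp0 //.
by move=> e' /negbTE ->; rewrite rmorph0 mul0r.
Qed.

Lemma reducibleD f g : reducible f -> reducible g ->
  reducible (fun z x => f z x + g z x).
Proof.
move=> [N [c fc]] [M [c' gc]].
exists (M + N)%N, (fun e => 'X^M * c e + 'X^N * c' e) => K z x Kx.
have h1 := reducible_at_shift M fc Kx.
have := reducible_at_shift N gc Kx; rewrite addnC => h2.
have := dvdp_add h1 h2; congr (_ %| _).
rewrite mulrDr addrACA -opprD -big_split /=; congr (_ - _).
by apply: eq_bigr => e _; rewrite rmorphD mulrDl.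
Qed.

Lemma reducibleM (p : {poly {poly F}}) f : reducible f ->
  reducible (fun z x => evz z p * f z x).
Proof.
move=> [N [c fc]]; exists N, (fun e => p * c e) => K z x /fc h.
have := dvdp_mull (evz z p) h; congr (_ %| _).
rewrite mulrBr mulrCA mulr_sumr; congr (_ - _).
by apply: eq_bigr => e _; rewrite rmorphM mulrA.
Qed.

Lemma eq_reducible f g : (forall z x, f z x = g z x) -> reducible f -> reducible g.
Proof. by move=> fg [N [c h]]; exists N, c => K z x /h; rewrite fg. Qed.

Lemma reducible_sum (I : Type) (r : seq I)
    (f : I -> F -> ('I_d -> {poly F}) -> {poly F}) :
  (forall i, reducible (f i)) -> reducible (fun z x => \sum_(i <- r) f i z x).
Proof.
move=> fr; elim: r => [|i r IH].
  exists 0%N, (fun=> 0) => K z x _.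
  by rewrite big_nil mulr0 big1 ?subrr ?dvdp0 // => e _; rewrite rmorph0 mul0r.
apply: eq_reducible (reducibleD (fr i) IH) => z x.
by rewrite big_cons.
Qed.

Lemma reducible_X f g : reducible g ->
  (forall K z x, approx K z x -> 'X^K %| 'X * f z x - g z x) -> reducible f.
Proof.
move=> [N [c gc]] fg; exists N.+1, c => K z x Kx.
have := dvdp_add (dvdp_mull 'X^N (fg _ _ _ Kx)) (gc _ _ _ Kx).
by rewrite mulrBr addrA subrK exprSr mulrA.
Qed.

(** Strong induction on the degree. A word with three letters [i] is $x_i^3w'$, and the deformed
    equation turns $Xx_i^3w'$ into $-(x_i(b_i+\sum_j s_{ij}x_j)+1)w'$, whose words are strictly
    shorter. *)
Lemma reducible_word w : reducible (fun _ x => word_mono x w).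
Proof.
have [n] := ubnP (size w); elim: n w => // n IH w; rewrite ltnS => wn.
have [/forallP small|] := boolP [forall i, (count_mem i w < 3)%N].
  apply: eq_reducible (reducible_basis [ffun i => Ordinal (small i)]) => z x.
  by rewrite word_monoE; apply: eq_bigr => i _; rewrite ffunE.
rewrite negb_forall => big.
have [i i3] : exists i : 'I_d, (2 < count_mem i w)%N.
  by case/existsP: big => i; rewrite -leqNgt; exists i.
have [w' pw] : exists w', perm_eq w [:: i, i, i & w'].
  have w1 : i \in w by rewrite -has_pred1 has_count; apply: leq_trans i3.
  have w2 : i \in rem i w.
    rewrite -has_pred1 has_count count_rem w1 /= eqxx.
    exact: leq_trans (leq_sub2r true i3).
  have w3 : i \in rem i (rem i w).
    rewrite -has_pred1 has_count !count_rem w2 w1 /= eqxx.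
    exact: leq_trans (leq_sub2r true (leq_sub2r true i3)).
  exists (rem i (rem i (rem i w))).
  rewrite (permPl (perm_to_rem w1)) perm_cons (permPl (perm_to_rem w2)) perm_cons.
  exact: perm_to_rem.
have sw : (size w' + 3 = size w)%N by rewrite (perm_size pw) /= addn3.
have R0 : reducible (fun _ x => word_mono x w') by apply: IH; lia.
have R1 : reducible (fun _ x => word_mono x (i :: w')) by apply: IH => /=; lia.
have R2 j : reducible (fun _ x => word_mono x [:: i, j & w'])
  by apply: IH => /=; lia.
pose g z x : {poly F} := evz z (-1) * (evz z (('X - (a i)%:P)%:P) * word_mono x (i :: w')
  + \sum_j evz z ((s i j)%:P%:P) * word_mono x [:: i, j & w'] + word_mono x w').
apply: (@reducible_X _ g).
  apply: reducibleM; apply: reducibleD R0; apply: reducibleD; first exact: reducibleM.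
  by apply: reducible_sum => j; apply: reducibleM.
move=> K z x /(_ i) Kx; have := dvdp_mulr (word_mono x w') Kx; congr (_ %| _).
rewrite /g /cubic_dyson /dyson_form [word_mono x w](perm_big _ pw) /word_mono /=.
rewrite !big_cons rmorphN rmorph1 !map_polyC /= !horner_evalE hornerXsubC.
under [X in _ = _ - _ * (_ + X + _)]eq_bigr => j _ do
  rewrite !big_cons map_polyC /= horner_evalE hornerC mulrCA mulrA -mulrA.
rewrite -mulr_sumr.
under [X in _ = _ - _ * (_ + _ * X + _)]eq_bigr => j _ do rewrite mulrA.
rewrite -mulr_suml.
ring.
Qed.

(** Determinant trick: modulo ['X^K], multiplication by ['X^N * x i0] acts on the finite vector of
    monomials by a matrix [M] polynomial in the parameter and [z]. Neither [P] nor [N] depends on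
    [K], [z] or the approximate solution. *)
Lemma reducible_char_poly (i0 : 'I_d) :
  exists (P : {poly {poly {poly F}}}) (N : nat), P \is monic /\
    forall K z x, approx K z x -> 'X^K %| (map_poly (evz z) P).['X^N * x i0].
Proof.
have /fin_all_exists [Nc NcP] e : exists Nc : nat * _,
    reducible_at (fun _ x => x i0 * exp_mono x e) Nc.1 Nc.2.
  have : reducible (fun _ x => x i0 * exp_mono x e).
    pose w := flatten [seq nseq (e i) i | i <- enum 'I_d].
    apply: eq_reducible (reducible_word (i0 :: w)) => z x.
    rewrite /word_mono big_cons; congr (_ * _).
    rewrite /w big_flatten big_map big_enum /=; apply: eq_bigr => i _.
    by rewrite big_nseq iter_mulr_1.
  by case=> N [c h]; exists (N, c).
pose T := {ffun 'I_d -> 'I_3}.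
(* [Nt] dominates all row exponents, so that one power of the parameter serves every row. *)
pose N e := (Nc e).1; pose Nt := (\sum_e N e)%N.
pose M : 'M[{poly {poly F}}]_#|T| := \matrix_(u, v)
  ('X^(Nt - N (enum_val u)) * (Nc (enum_val u)).2 (enum_val v)).
exists (char_poly M), Nt; split=> [|K z x Kx]; first exact: char_poly_monic.
set y := 'X^Nt * x i0.
have hK u : 'X^K %| y * exp_mono x (enum_val u)
    - \sum_v map_mx (evz z) M u v * exp_mono x (enum_val v).
  have Nu : (N (enum_val u) <= Nt)%N by rewrite /Nt (bigD1 (enum_val u)) //= leq_addr.
  have := reducible_at_shift (Nt - N (enum_val u)) (@NcP (enum_val u)) Kx.
  rewrite subnK // -mulrA; congr (_ %| _ - _).
  rewrite (reindex_onto enum_val enum_rank) /=; last by move=> i _; rewrite enum_rankK.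
  apply: eq_big => v; first by rewrite enum_valK eqxx.
  by move=> _; rewrite !mxE.
pose B := y%:M - map_mx (evz z) M.
have BE : (map_poly (evz z) (char_poly M)).[y] = \det B.
  rewrite map_char_poly /char_poly -[LHS]/(horner_eval y _) -det_map_mx; congr (\det _).
  apply/matrixP => u v; rewrite !mxE /= horner_evalE !hornerE.
  by case: eqP; rewrite ?mulr1n ?mulr0n !hornerE.
pose U : 'cV[{poly F}]_#|T| := \col_v exp_mono x (enum_val v).
have BU u : 'X^K %| (B *m U) u 0.
  have := hK u; congr (_ %| _).
  rewrite /B mulmxBl mxE mul_scalar_mx !mxE; congr (_ - _).
  by apply: eq_bigr => v _; rewrite !mxE.
(* The monomial with exponent zero is 1, so the adjugate identity at its entry isolates the
   determinant. *)
pose e0 : T := [ffun=> ord0].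
have : (\adj B *m (B *m U)) (enum_rank e0) 0 = \det B.
  rewrite mulmxA mul_adj_mx mul_scalar_mx !mxE enum_rankK /exp_mono big1 ?mulr1 //.
  by move=> i _; rewrite ffunE.
rewrite BE => <-; rewrite mxE.
by elim/big_ind: _ => [|p q|v _]; [exact: dvdp0|exact: dvdp_add|exact: dvdp_mull].
Qed.

End Elimination.

(** Factor out the largest power of the inner variable dividing all coefficients; the size of the
    leading coefficient drops with each division. *)
Lemma poly_lowest_order (A : idomainType) (P : {poly {poly A}}) : P != 0 ->
  exists e R, P = R * ('X^e)%:P /\ map_poly (horner_eval 0) R != 0.
Proof.
have [n] := ubnP (size (lead_coef P)); elim: n P => // n IH P; rewrite ltnS => Pn P0.
have [E|] := eqVneq (map_poly (horner_eval 0) P) 0; last first.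
  by exists 0%N, P; rewrite expr0 mulr1.
pose R := \poly_(k < size P) drop_poly 1 P`_k.
have PR : P = R * 'X%:P.
  apply/polyP => k; rewrite coefMC coef_poly.
  case: ltnP => kP; last by rewrite mul0r nth_default.
  rewrite -[LHS](poly_take_drop 1) expr1 -[RHS]add0r; congr (_ + _).
  apply/polyP => -[|j]; rewrite coef_take_poly coef0 //=.
  have := congr1 (fun p : {poly A} => p`_k) E.
  by rewrite coef_map coef0 /= horner_evalE horner_coef0.
have R0 : R != 0 by apply: contraNneq P0 => R0; rewrite PR R0 mul0r.
have [|e [Q [RQ Q0]]] := IH R _ R0.
  by move: Pn; rewrite PR lead_coefM lead_coefC size_mulX ?lead_coef_eq0.
exists e.+1, Q; split=> //.
by rewrite PR RQ -mulrA -polyCM -exprSr.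
Qed.

(** [Q] is the lowest-order coefficient, in the deformation parameter, of the characteristic
    polynomial taken at ['X^N] times the unknown; it depends neither on [z] nor on the solution. *)
Theorem dyson_algebraic (F : fieldType) (d : nat) (s : 'I_d -> 'I_d -> F)
    (a : 'I_d -> F) (i0 : 'I_d) :
  exists2 Q : {poly {poly F}}, Q != 0 & forall z m,
    (forall i, dyson_form s (fun i => z - a i) m i = 0) ->
    (forall y, (forall i, dyson_jacobian s (fun i => z - a i) m y i = 0) ->
       forall i, y i = 0) ->
    (map_poly (horner_eval z) Q).[m i0] = 0.
Proof.
have [P [N [Pm PK]]] := reducible_char_poly s a i0.
pose P2 := P \Po (('X^N)%:P * 'X).
have XN0 : 'X^N != 0 :> {poly {poly F}} by rewrite expf_neq0 ?polyX_eq0.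
have P20 : P2 != 0.
  rewrite -size_poly_eq0 size_comp_poly2 ?size_poly_eq0 ?monic_neq0 //.
  by rewrite mul_polyC size_scale // size_polyX.
have [e [R [RE R0]]] := poly_lowest_order P20.
exists (map_poly (horner_eval 0) R) => // z m sol inj.
(* One order more than the stripped power [e]: a factor ['X] is left to divide [R] at the lift, and
   at parameter 0 this is the relation for [m]. *)
have [x [x0 xK]] := cubic_dyson_lift inj sol e.+1.
have := PK _ _ _ xK.
pose ev := map_poly (horner_eval z).
have -> : (map_poly ev P).['X^N * x i0] = (map_poly ev P2).[x i0].
  rewrite map_comp_poly horner_comp rmorphM /= map_polyC map_polyX /= /ev map_polyXn.
  by rewrite !hornerE.
rewrite RE rmorphM /= map_polyC /= map_polyXn hornerM hornerC exprS.
rewrite dvdp_mul2r ?expf_neq0 ?polyX_eq0 //.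
rewrite -['X]subr0 -(polyC0 F) -root_factor_theorem => /rootP.
rewrite -horner_evalE -horner_map /= !horner_evalE x0 => h.
rewrite -[RHS]h; congr (_.[_]); apply/polyP => k.
rewrite !coef_map /= !horner_evalE.
by rewrite !horner_coef0 coef_map.
Qed.

(** * Stability of the Dyson equation *)

Section ComplexModulus.
Variable R : realType.
Implicit Types z w : R[i].

Lemma normc_cabs z : `|z| = (cabs z)%:C.
Proof. by rewrite /cabs normc_def. Qed.

Lemma cabs_ge0 z : 0 <= cabs z.
Proof. by rewrite -lecR -normc_cabs normr_ge0. Qed.

Lemma cabsM z w : cabs (z * w) = cabs z * cabs w.
Proof. by apply: complexI; rewrite rmorphM /= -!normc_cabs normrM. Qed.

Lemma cabsX z n : cabs (z ^+ n) = cabs z ^+ n.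
Proof. by apply: complexI; rewrite rmorphXn /= -!normc_cabs normrX. Qed.

Lemma cabsN z : cabs (- z) = cabs z.
Proof. by apply: complexI; rewrite -!normc_cabs normrN. Qed.

Lemma cabs_distC z w : cabs (z - w) = cabs (w - z).
Proof. by rewrite -cabsN opprB. Qed.

Lemma cabs0 : cabs (0 : R[i]) = 0.
Proof. by apply: complexI; rewrite -normc_cabs normr0. Qed.

Lemma cabs1 : cabs (1 : R[i]) = 1.
Proof. by apply: complexI; rewrite -normc_cabs normr1. Qed.

Lemma cabs_eq0 z : (cabs z == 0) = (z == 0).
Proof. by rewrite -[RHS]normr_eq0 normc_cabs -(inj_eq (@complexI R)). Qed.

Lemma cabs_gt0 z : (0 < cabs z) = (z != 0).
Proof. by rewrite lt_def cabs_ge0 andbT cabs_eq0. Qed.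

Lemma ler_cabsD z w : cabs (z + w) <= cabs z + cabs w.
Proof. by rewrite -lecR rmorphD /= -!normc_cabs ler_normD. Qed.

Lemma ler_cabsB z w : cabs (z - w) <= cabs z + cabs w.
Proof. by rewrite -(cabsN w) ler_cabsD. Qed.

Lemma ler_cabs_dist u z w : cabs (z - w) <= cabs (z - u) + cabs (u - w).
Proof. by rewrite -(subrKA u) ler_cabsD. Qed.

Lemma ler_cabs_sum (I : Type) (r : seq I) (P : pred I) (F : I -> R[i]) :
  cabs (\sum_(i <- r | P i) F i) <= \sum_(i <- r | P i) cabs (F i).
Proof.
elim/big_rec2: _ => [|i y1 y2 _ h]; first by rewrite cabs0.
by apply: le_trans (ler_cabsD _ _) _; rewrite lerD2l.
Qed.

Lemma cabs_real (x : R) : cabs x%:C = `|x|.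
Proof. by rewrite /cabs normc_def /= expr0n /= addr0 sqrtr_sqr. Qed.

Lemma sqr_cabs z : cabs z ^+ 2 = complex.Re z ^+ 2 + complex.Im z ^+ 2.
Proof. by apply: complexI; rewrite add_Re2_Im2 rmorphXn /= normc_cabs. Qed.

Lemma Re_le_cabs z : `|complex.Re z| <= cabs z.
Proof.
rewrite -(@ler_pXn2r _ 2) ?nnegrE ?cabs_ge0 // sqr_cabs real_normK ?num_real //.
by rewrite lerDl sqr_ge0.
Qed.

Lemma Im_le_cabs z : `|complex.Im z| <= cabs z.
Proof.
rewrite -(@ler_pXn2r _ 2) ?nnegrE ?cabs_ge0 // sqr_cabs real_normK ?num_real //.
by rewrite lerDr sqr_ge0.
Qed.

Lemma cabs_le_ReIm z : cabs z <= `|complex.Re z| + `|complex.Im z|.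
Proof.
rewrite -(@ler_pXn2r _ 2) ?nnegrE ?cabs_ge0 ?addr_ge0 // sqr_cabs sqrrD.
rewrite !real_normK ?num_real // lerD2r lerDl.
by rewrite mulrn_wge0 ?mulr_ge0.
Qed.

Lemma ReB z w : complex.Re (z - w) = complex.Re z - complex.Re w.
Proof. by case: z w => [? ?] [? ?]. Qed.

Lemma ImB z w : complex.Im (z - w) = complex.Im z - complex.Im w.
Proof. by case: z w => [? ?] [? ?]. Qed.

Lemma ImD z w : complex.Im (z + w) = complex.Im z + complex.Im w.
Proof. by case: z w => [? ?] [? ?]. Qed.

Lemma ImN z : complex.Im (- z) = - complex.Im z.
Proof. by case: z. Qed.

Lemma Im_real_mul (x : R) z : @complex.Im R (x%:C * z) = x * complex.Im z.
Proof. by case: z => [a b] /=; rewrite mul0r addr0. Qed.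

Lemma Im_sum (I : Type) (r : seq I) (P : pred I) (F : I -> R[i]) :
  complex.Im (\sum_(i <- r | P i) F i) = \sum_(i <- r | P i) complex.Im (F i).
Proof. by apply: (big_morph _ ImD). Qed.

Lemma ImV z : complex.Im z^-1 = - complex.Im z / cabs z ^+ 2.
Proof.
have [->|z0] := eqVneq z 0; first by rewrite invr0 /= oppr0 mul0r.
by rewrite sqr_cabs; case: z z0 => [x y] _ /=; rewrite mulNr.
Qed.

End ComplexModulus.

(** * A priori bounds and contraction estimates *)

Section DysonBounds.
Variables (R : realType) (d : nat) (S : 'M[R]_d) (a : 'cV[R]_d).
Hypothesis S_ge0 : forall i j, 0 <= S i j.

Lemma dyson_neq0 z u : dyson_solution S a z u -> forall i, u i 0 != 0.
Proof.
move=> us i; apply: contraTneq (us i).1 => u0.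
by rewrite /Cplus /= u0 /= ltxx.
Qed.

Lemma dyson_prodE z u : dyson_solution S a z u -> forall i,
  u i 0 * (z - (a i 0)%:C + \sum_j (S i j)%:C * u j 0) = -1.
Proof.
move=> us i; rewrite -(us i).2 mul1r mulrN divff //.
exact: dyson_neq0 us i.
Qed.

(** Imaginary part of the equation times $|u_i|^2$. The upper bound, the two stability estimates and
    the comparability all rest on it. *)
Lemma dyson_ImE z u : dyson_solution S a z u -> forall i,
  complex.Im (u i 0) = cabs (u i 0) ^+ 2 *
    (complex.Im z + \sum_j S i j * complex.Im (u j 0)).
Proof.
move=> us i; have u0 : cabs (u i 0) ^+ 2 != 0.
  by rewrite expf_neq0 // cabs_eq0 (dyson_neq0 us).
have := congr1 (@complex.Im R) (us i).2.
rewrite mul1r ImN ImV ImD ImB /= subr0 Im_sum.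
rewrite (eq_bigr _ (fun j _ => Im_real_mul (S i j) (u j 0))).
move=> <-; rewrite mulNr opprK mulrC mulfVK //.
Qed.

Lemma dyson_Im_gt0 z u : dyson_solution S a z u -> forall i, 0 < complex.Im (u i 0).
Proof. by move=> us i; case: (us i). Qed.

(** Dropping the nonnegative sum from [dyson_ImE] leaves
    $|u_i|^2\operatorname{Im}z\le\operatorname{Im}u_i\le|u_i|$. *)
Lemma dyson_le_inv z u : 0 < complex.Im z -> dyson_solution S a z u -> forall i,
  cabs (u i 0) <= (complex.Im z)^-1.
Proof.
move=> z0 us i.
have u0 : 0 < cabs (u i 0) by rewrite cabs_gt0 (dyson_neq0 us).
have : cabs (u i 0) ^+ 2 * complex.Im z <= cabs (u i 0).
  apply: le_trans (le_trans (ler_norm _) (Im_le_cabs (u i 0))).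
  rewrite [leRHS](dyson_ImE us) ler_wpM2l ?sqr_ge0 // lerDl.
  apply: sumr_ge0 => j _; apply: mulr_ge0; first exact: S_ge0.
  exact/ltW/(dyson_Im_gt0 us).
by rewrite expr2 -mulrA ger_pMr // -ler_pdivlMr // mul1r.
Qed.

(** The product of [u i 0] and its cofactor in the equation is -1, and an upper bound on [u] bounds
    the cofactor. *)
Lemma dyson_ge z u (Phi : R) : dyson_solution S a z u ->
  (forall i, cabs (u i 0) <= Phi) -> forall i,
  1 <= cabs (u i 0) * (cabs z + `|a i 0| + (\sum_j S i j) * Phi).
Proof.
move=> us uP i; rewrite -(@cabs1 R) -cabsN -(dyson_prodE us i) cabsM.
rewrite ler_wpM2l ?cabs_ge0 //.
apply: le_trans (ler_cabsD _ _) _; apply: lerD.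
  by rewrite (le_trans (ler_cabsB _ _)) // cabs_real.
apply: le_trans (ler_cabs_sum _ _ _) _; rewrite mulr_suml; apply: ler_sum => j _.
by rewrite cabsM cabs_real ger0_norm ?S_ge0 // ler_wpM2l ?S_ge0.
Qed.

(** If both sums are positive, dividing by them reduces the claim to the arithmetic-geometric mean
    inequality term by term; if one vanishes, so does every term on the left. *)
Lemma weighted_cauchy_schwarz (I : finType) (s x y : I -> R) :
  (forall i, 0 <= s i) -> (forall i, 0 <= x i) -> (forall i, 0 <= y i) ->
  \sum_i s i * Num.sqrt (x i * y i) <=
    Num.sqrt ((\sum_i s i * x i) * (\sum_i s i * y i)).
Proof.
move=> s0 x0 y0.
have X0 : 0 <= \sum_i s i * x i by apply: sumr_ge0 => i _; rewrite mulr_ge0.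
have Y0 : 0 <= \sum_i s i * y i by apply: sumr_ge0 => i _; rewrite mulr_ge0.
set X := (X in Num.sqrt (X * _)); set Y := (X in Num.sqrt (_ * X)).
have [XY|XY] := eqVneq (X * Y) 0.
  rewrite XY sqrtr0 big1 // => i _.
  have [->|si] := eqVneq (s i) 0; first by rewrite mul0r.
  suff -> : x i * y i = 0 by rewrite sqrtr0 mulr0.
  move/eqP: XY; rewrite mulf_eq0 => /orP[] /eqP h.
    have /eqP := psumr_eq0P (fun i _ => mulr_ge0 (s0 i) (x0 i)) h (i := i) isT.
    by rewrite mulf_eq0 (negbTE si) /= => /eqP ->; rewrite mul0r.
  have /eqP := psumr_eq0P (fun i _ => mulr_ge0 (s0 i) (y0 i)) h (i := i) isT.
  by rewrite mulf_eq0 (negbTE si) /= => /eqP ->; rewrite mulr0.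
move: XY; rewrite mulf_eq0 negb_or => /andP[Xn0 Yn0].
have Xp : 0 < X by rewrite lt_def Xn0. have Yp : 0 < Y by rewrite lt_def Yn0.
have XYp : 0 < Num.sqrt (X * Y) by rewrite sqrtr_gt0 mulr_gt0.
have amgm i : s i * Num.sqrt (x i * y i) <=
    Num.sqrt (X * Y) / 2 * (s i * x i / X + s i * y i / Y).
  have -> : Num.sqrt (X * Y) / 2 * (s i * x i / X + s i * y i / Y) =
    s i * (Num.sqrt (X * Y) / 2 * (x i / X + y i / Y)) by ring.
  rewrite ler_wpM2l //.
  rewrite !sqrtrM ?(ltW Xp) //.
  set p := Num.sqrt (x i); set q := Num.sqrt (y i).
  have -> : x i = p ^+ 2 by rewrite sqr_sqrtr.
  have -> : y i = q ^+ 2 by rewrite sqr_sqrtr.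
  have : X = Num.sqrt X ^+ 2 by rewrite sqr_sqrtr // ltW.
  have : Y = Num.sqrt Y ^+ 2 by rewrite sqr_sqrtr // ltW.
  have : 0 < Num.sqrt X by rewrite sqrtr_gt0.
  have : 0 < Num.sqrt Y by rewrite sqrtr_gt0.
  move: (Num.sqrt Y) (Num.sqrt X) => h k h0 k0 -> ->.
  rewrite -subr_ge0.
  have -> : k * h / 2 * (p ^+ 2 / k ^+ 2 + q ^+ 2 / h ^+ 2) - p * q =
    k * h / 2 * (p / k - q / h) ^+ 2.
    by field; rewrite !gt_eqF.
  by rewrite mulr_ge0 ?sqr_ge0 // divr_ge0 // mulr_ge0 // ltW.
apply: le_trans (ler_sum _ (fun i _ => amgm i)) _.
rewrite -mulr_sumr big_split /= -!mulr_suml -/X -/Y !divff //.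
by rewrite -mulrA mulVf ?mulr1 // pnatr_eq0.
Qed.

(** Measured in units of $\operatorname{Im}u_j$, the linearised map contracts: at an index
    maximising $|y_j|/\operatorname{Im}u_j$ the identity for the imaginary part loses the term
    $|u_i|^2\operatorname{Im}z$, which forces the maximum to be at most 0. *)
Lemma dyson_jacobian_inj z u : 0 < complex.Im z -> dyson_solution S a z u ->
  forall y, (forall i, dyson_jacobian (fun i j => (S i j)%:C)
      (fun i => z - (a i 0)%:C) (fun i => u i 0) y i = 0) -> forall i, y i = 0.
Proof.
move=> z0 us y yJ i0.
have v0 := dyson_Im_gt0 us.
pose F i := cabs (y i) / complex.Im (u i 0).
have [i _ imax] : exists2 i, true & forall j, F j <= F i.
  by case: (@arg_maxP _ _ _ i0 xpredT F isT) => i _ h; exists i => // j; exact: h.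
have yle j : cabs (y j) <= F i * complex.Im (u j 0).
  by rewrite -ler_pdivrMr // imax.
have yE : y i = u i 0 ^+ 2 * \sum_j (S i j)%:C * y j.
  have := congr1 ( *%R (u i 0)) (yJ i).
  rewrite /dyson_jacobian mulrDr mulrCA (dyson_prodE us) mulr0 mulrN1 => /eqP.
  by rewrite addrC subr_eq0 => /eqP <-; rewrite expr2 mulrA.
have : cabs (y i) <= F i * complex.Im (u i 0) - F i * (cabs (u i 0) ^+ 2 * complex.Im z).
  rewrite {1}yE cabsM cabsX (dyson_ImE us i).
  have -> : F i * (cabs (u i 0) ^+ 2 * (complex.Im z + \sum_j S i j * complex.Im (u j 0)))
     - F i * (cabs (u i 0) ^+ 2 * complex.Im z) =
     cabs (u i 0) ^+ 2 * (\sum_j S i j * (F i * complex.Im (u j 0))).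
    under [in RHS]eq_bigr => j _ do rewrite mulrCA.
    rewrite -mulr_sumr; ring.
  rewrite ler_wpM2l ?sqr_ge0 //; apply: le_trans (ler_cabs_sum _ _ _) _.
  by apply: ler_sum => j _; rewrite cabsM cabs_real ger0_norm ?S_ge0 // ler_wpM2l ?S_ge0.
rewrite {1}/F divfK ?gt_eqF // lerDl oppr_ge0 pmulr_lle0; last first.
  by rewrite mulr_gt0 // exprn_gt0 // cabs_gt0 (dyson_neq0 us).
move=> Fi; apply/eqP; rewrite -cabs_eq0 eq_le cabs_ge0 andbT.
by rewrite (le_trans (yle i0)) // mulr_le0_ge0 // ltW.
Qed.

(** The contraction argument for two solutions, in units of
    $\sqrt{\operatorname{Im}u_j\operatorname{Im}u'_j}$; the difference equation is exact, with
    $u_iu'_i$ in place of $u_i^2$. *)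
Lemma dyson_dist z z' u u' : 0 < complex.Im z -> 0 < complex.Im z' ->
  dyson_solution S a z u -> dyson_solution S a z' u' ->
  forall i, cabs (u i 0 - u' i 0) <= cabs (z - z') / (complex.Im z * complex.Im z').
Proof.
move=> z0 z'0 us us' i0.
have v0 := dyson_Im_gt0 us; have v'0 := dyson_Im_gt0 us'.
pose W i := Num.sqrt (complex.Im (u i 0) * complex.Im (u' i 0)).
have W0 i : 0 < W i by rewrite sqrtr_gt0 mulr_gt0.
pose F i := cabs (u i 0 - u' i 0) / W i.
have [i _ imax] : exists2 i, true & forall j, F j <= F i.
  by case: (@arg_maxP _ _ _ i0 xpredT F isT) => i _ h; exists i => // j; exact: h.
have F0 : 0 <= F i by rewrite divr_ge0 ?cabs_ge0 // ltW.
have le_W j : cabs (u j 0 - u' j 0) <= F i * W j by rewrite -ler_pdivrMr // imax.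
have dE : u i 0 - u' i 0 =
    u i 0 * u' i 0 * (z - z' + \sum_j (S i j)%:C * (u j 0 - u' j 0)).
  under [in RHS]eq_bigr => j _ do rewrite mulrBr.
  rewrite sumrB.
  have := dyson_prodE us i; have := dyson_prodE us' i.
  move: (\sum_j _) (\sum_j _) => A B hB hA.
  have -> : u i 0 * u' i 0 * (z - z' + (A - B)) =
     (u i 0 * (z - (a i 0)%:C + A)) * u' i 0 - (u' i 0 * (z' - (a i 0)%:C + B)) * u i 0.
    ring.
  by rewrite hA hB; ring.
pose p := cabs (u i 0); pose q := cabs (u' i 0).
have p0 : 0 < p by rewrite cabs_gt0 (dyson_neq0 us).
have q0 : 0 < q by rewrite cabs_gt0 (dyson_neq0 us').
pose P := \sum_j S i j * complex.Im (u j 0).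
pose Q := \sum_j S i j * complex.Im (u' j 0).
have P0 : 0 <= P by apply: sumr_ge0 => j _; rewrite mulr_ge0 ?S_ge0 ?ltW.
have Q0 : 0 <= Q by apply: sumr_ge0 => j _; rewrite mulr_ge0 ?S_ge0 ?ltW.
pose e := complex.Im z; pose e' := complex.Im z'.
(* Cauchy-Schwarz for two summands: $\sqrt{PQ}+\sqrt{ee'}\le\sqrt{(e+P)(e'+Q)}$. *)
have Wi : p * q * (Num.sqrt (P * Q) + Num.sqrt (e * e')) <= W i.
  rewrite /W (dyson_ImE us) (dyson_ImE us') -/p -/q -/P -/Q -/e -/e'.
  have -> : p ^+ 2 * (e + P) * (q ^+ 2 * (e' + Q)) =
    (p * q) ^+ 2 * ((e + P) * (e' + Q)) by ring.
  rewrite [Num.sqrt ((p * q) ^+ 2 * _)]sqrtrM ?sqr_ge0 // sqrtr_sqr ger0_norm ?mulr_ge0 ?(ltW p0) ?(ltW q0) //.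
  rewrite ler_pM2l ?mulr_gt0 //.
  rewrite !sqrtrM ?addr_ge0 ?(ltW z0) ?(ltW z'0) //.
  rewrite -(@ler_pXn2r _ 2) ?nnegrE ?addr_ge0 ?mulr_ge0 ?sqrtr_ge0 //.
  rewrite exprMn !sqr_sqrtr ?addr_ge0 ?(ltW z0) ?(ltW z'0) //.
  move: (sqrtr_ge0 P) (sqrtr_ge0 Q) (sqrtr_ge0 e) (sqrtr_ge0 e').
  have := sqr_sqrtr P0; have := sqr_sqrtr Q0.
  have := sqr_sqrtr (ltW z0); have := sqr_sqrtr (ltW z'0); rewrite -/e -/e'.
  move: (Num.sqrt P) (Num.sqrt Q) (Num.sqrt e) (Num.sqrt e') => A B C D.
  move=> <- <- <- <- A0 B0 C0 D0; rewrite -subr_ge0.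
  have -> : (C ^+ 2 + A ^+ 2) * (D ^+ 2 + B ^+ 2) - (A * B + C * D) ^+ 2 =
    (C * B - A * D) ^+ 2 by ring.
  exact: sqr_ge0.
have : F i * W i <= p * q * cabs (z - z') + F i * (p * q * Num.sqrt (P * Q)).
  rewrite {1}/F divfK ?gt_eqF // dE cabsM cabsM -/p -/q.
  rewrite [F i * _]mulrCA -mulrDr ler_pM2l ?mulr_gt0 //.
  apply: le_trans (ler_cabsD _ _) _; rewrite lerD2l.
  apply: le_trans (ler_cabs_sum _ _ _) _.
  have := weighted_cauchy_schwarz (S_ge0 i) (fun j => ltW (v0 j)) (fun j => ltW (v'0 j)).
  move=> /(ler_wpM2l F0); apply: le_trans; rewrite mulr_sumr; apply: ler_sum => j _.
  by rewrite cabsM cabs_real ger0_norm ?S_ge0 // mulrCA ler_wpM2l ?S_ge0.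
(* The terms with $\sqrt{PQ}$ cancel, leaving $F_i\sqrt{ee'}\le|z-z'|$. *)
move=> /(le_trans (ler_wpM2l F0 Wi)).
rewrite mulrDr mulrDr addrC lerD2r mulrCA ler_pM2l ?mulr_gt0 // => Fle.
have ee0 : 0 < Num.sqrt (e * e') by rewrite sqrtr_gt0 mulr_gt0.
have W1 : W i0 <= (Num.sqrt (e * e'))^-1.
  rewrite -sqrtrV ?mulr_ge0 ?(ltW z0) ?(ltW z'0) // ler_wsqrtr // invfM.
  apply: ler_pM; rewrite ?(ltW (v0 _)) ?(ltW (v'0 _)) //.
    exact: le_trans (le_trans (ler_norm _) (Im_le_cabs _)) (dyson_le_inv z0 us i0).
  exact: le_trans (le_trans (ler_norm _) (Im_le_cabs _)) (dyson_le_inv z'0 us' i0).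
apply: le_trans (le_W i0) _.
apply: le_trans (ler_wpM2l F0 W1) _.
rewrite ler_pdivrMr // -/e -/e' mulrAC ler_pdivlMr ?mulr_gt0 //.
have {1}-> : e * e' = Num.sqrt (e * e') ^+ 2 by rewrite sqr_sqrtr // mulr_ge0 ?ltW.
by rewrite expr2 mulrA ler_pM2r.
Qed.

End DysonBounds.

(** * Hoelder continuity of bounded algebraic functions *)

(** Induction on the degree by divided differences: $q=q_1(X-w_0)+q(w_0)$, and $q_1$ is at most
    $2e/h$ in modulus at the other nodes. *)
Lemma separated_nodes_coef_bound (R : realType) (n : nat) (B : R) : 0 <= B ->
  exists2 K : R, 0 < K & forall (q : {poly R[i]}) (w : nat -> R[i]) (e h : R),
    (size q <= n.+1)%N -> 0 < h ->
    (forall j, (j <= n)%N -> cabs (w j) <= B) ->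
    (forall j k, (j < k <= n)%N -> h <= cabs (w j - w k)) ->
    (forall j, (j <= n)%N -> cabs q.[w j] <= e) ->
    forall k, cabs q`_k * h ^+ n <= K * e.
Proof.
move=> B0; elim: n => [|n [K K0 IH]].
  exists 1 => // q w e h q1 h0 _ _ qe k; rewrite expr0 mulr1 mul1r.
  rewrite [q]size1_polyC // in qe *; rewrite coefC.
  have := qe 0%N isT; rewrite hornerC => qe0.
  by case: eqP => _ //; rewrite cabs0; apply: le_trans qe0; exact: cabs_ge0.
(* Each coefficient of [q] involves at most two of [q1], weighted 1 and [B], which gives $2K(1+B)$;
   the constant $q(w_0)$ contributes $(2B)^{n+1}$ because $h\le 2B$. *)
exists ((2 * B) ^+ n.+1 + 2 * K * (1 + B)) => [|q w e h qn h0 wB wh qe k].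
  rewrite ltr_wpDl ?exprn_ge0 ?mulr_ge0 // !mulr_gt0 //.
  by rewrite ltr_wpDr.
have e0 : 0 <= e := le_trans (cabs_ge0 _) (qe 0%N isT).
have /factor_theorem [q1 q1E] : root (q - q.[w 0%N]%:P) (w 0%N).
  by rewrite rootE !hornerE subrr.
have qE : q = q1 * ('X - (w 0%N)%:P) + q.[w 0%N]%:P by rewrite -q1E subrK.
have s1 : (size q1 <= n.+1)%N.
  have [->|q10] := eqVneq q1 0; first by rewrite size_poly0.
  have : (size (q1 * ('X - (w 0%N)%:P))%R <= n.+2)%N.
    rewrite -q1E (leq_trans (size_polyD _ _)) // size_polyN geq_max qn.
    by rewrite (leq_trans (size_polyC_leq1 _)).
  by rewrite size_Mmonic ?monicXsubC // size_XsubC addn2.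
have bound k' : cabs q1`_k' * h ^+ n.+1 <= 2 * K * e.
  rewrite exprSr mulrA -ler_pdivlMr // [leRHS](_ : _ = K * (2 * e / h)); last by ring.
  apply: (IH q1 (fun j => w j.+1) (2 * e / h) h s1 h0); first by move=> j jn; exact: wB.
    by move=> j k1 jk; apply: wh; move: jk; rewrite ltnS.
  move=> j jn.
  have hw : h <= cabs (w j.+1 - w 0%N) by rewrite cabs_distC wh.
  rewrite ler_pdivlMr // (le_trans (ler_wpM2l (cabs_ge0 _) hw)) // -cabsM.
  have -> : q1.[w j.+1] * (w j.+1 - w 0%N) = q.[w j.+1] - q.[w 0%N].
    by have /= := congr1 (horner^~ (w j.+1)) qE; rewrite !hornerE => ->; rewrite addrK.
  by rewrite (le_trans (ler_cabsB _ _)) // mulr_natl mulr2n lerD ?qe.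
have hB : h <= 2 * B.
  rewrite (le_trans (wh 0%N 1%N isT)) // (le_trans (ler_cabsB _ _)) //.
  by rewrite mulr_natl mulr2n lerD ?wB.
have qk : cabs q`_k <= e + (if k is k'.+1 then cabs q1`_k' else 0) + B * cabs q1`_k.
  rewrite qE mulrBr !coefD coefN coefMX coefMC coefC.
  apply: le_trans (ler_cabsD _ _) _.
  rewrite addrC -addrA; apply: lerD.
    by case: (k == 0%N); rewrite ?cabs0 ?qe.
  apply: le_trans (ler_cabsB _ _) _; apply: lerD.
    by case: k => [|k]; rewrite ?cabs0.
  by rewrite cabsM mulrC ler_wpM2r ?cabs_ge0 ?wB.
have hn0 : 0 <= h ^+ n.+1 by rewrite exprn_ge0 ?ltW.
apply: le_trans (ler_wpM2r hn0 qk) _.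
rewrite [leRHS](_ : _ = e * (2 * B) ^+ n.+1 + 2 * K * e + B * (2 * K * e)); last by ring.
rewrite 2!mulrDl -[B * _ * _]mulrA; apply: lerD; last by rewrite ler_wpM2l.
apply: lerD; first by rewrite ler_wpM2l // lerXn2r ?nnegrE ?mulr_ge0 // ltW.
case: k {qk} => [|k]; last exact: bound.
by rewrite mul0r !mulr_ge0 // ltW.
Qed.

(** * Bounded Lipschitz functions *)

Section LipschitzOn.
Variable R : realType.
Implicit Types (A : set R[i]) (f g : R[i] -> R[i]).

(** Boundedness is part of the notion so that products remain in the class. *)
Definition lip_on A f := exists M L, [/\ 0 <= M, 0 <= L,
  forall z, A z -> cabs (f z) <= M &
  forall z w, A z -> A w -> cabs (f z - f w) <= L * cabs (z - w)].

Lemma lip_on_cst A c : lip_on A (fun=> c).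
Proof.
exists (cabs c), 0; split=> // [|z w _ _]; first exact: cabs_ge0.
by rewrite subrr cabs0 mul0r.
Qed.

Lemma lip_on_id A (B : R) : 0 <= B -> (forall z, A z -> cabs z <= B) -> lip_on A id.
Proof. by move=> B0 AB; exists B, 1; split=> // z w _ _; rewrite mul1r. Qed.

Lemma lip_onD A f g : lip_on A f -> lip_on A g -> lip_on A (fun z => f z + g z).
Proof.
move=> [M [L [M0 L0 Mb Lb]]] [M' [L' [M'0 L'0 Mb' Lb']]].
exists (M + M'), (L + L'); split; rewrite ?addr_ge0 // => z.
  by move=> Az; rewrite (le_trans (ler_cabsD _ _)) // lerD ?Mb ?Mb'.
move=> w Az Aw; rewrite opprD addrACA mulrDl (le_trans (ler_cabsD _ _)) //.
by rewrite lerD ?Lb ?Lb'.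
Qed.

Lemma lip_onM A f g : lip_on A f -> lip_on A g -> lip_on A (fun z => f z * g z).
Proof.
move=> [M [L [M0 L0 Mb Lb]]] [M' [L' [M'0 L'0 Mb' Lb']]].
exists (M * M'), (M * L' + L * M'); split; rewrite ?addr_ge0 ?mulr_ge0 // => z.
  by move=> Az; rewrite cabsM ler_pM ?cabs_ge0 ?Mb ?Mb'.
move=> w Az Aw; have -> : f z * g z - f w * g w =
  f z * (g z - g w) + (f z - f w) * g w by ring.
rewrite (le_trans (ler_cabsD _ _)) // !cabsM mulrDl lerD //.
  by rewrite -mulrA ler_pM ?cabs_ge0 ?Mb ?Lb'.
by rewrite mulrAC ler_pM ?cabs_ge0 ?Mb' ?Lb.
Qed.

Lemma lip_onX A f n : lip_on A f -> lip_on A (fun z => f z ^+ n).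
Proof.
move=> Af; elim: n => [|n IH]; first exact: lip_on_cst.
under [X in lip_on _ X]funext => z do rewrite exprS.
exact: lip_onM.
Qed.

Lemma lip_on_sum A (I : Type) (r : seq I) (F : I -> R[i] -> R[i]) :
  (forall i, lip_on A (F i)) -> lip_on A (fun z => \sum_(i <- r) F i z).
Proof.
move=> AF; elim: r => [|i r IH].
  by under [X in lip_on _ X]funext => z do rewrite big_nil; exact: lip_on_cst.
under [X in lip_on _ X]funext => z do rewrite big_cons.
exact: lip_onD.
Qed.

Lemma lip_on_horner A (p : {poly R[i]}) f : lip_on A f -> lip_on A (fun z => p.[f z]).
Proof.
move=> Af; under [X in lip_on _ X]funext => z do rewrite horner_coef.
by apply: lip_on_sum => i; apply: lip_onM; [exact: lip_on_cst|exact: lip_onX].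
Qed.

Lemma lip_on_horner2 A (P : {poly {poly R[i]}}) f : lip_on A id -> lip_on A f ->
  lip_on A (fun z => (map_poly (horner_eval z) P).[f z]).
Proof.
move=> Aid Af.
have -> : (fun z => (map_poly (horner_eval z) P).[f z]) =
    fun z => \sum_(i < size P) (P`_i).[z] * f z ^+ i.
  apply/funext => z; rewrite (horner_coef_wide _ (size_poly _ _)).
  by apply: eq_bigr => i _; rewrite coef_map /= horner_evalE.
apply: lip_on_sum => i; apply: lip_onM; last exact: lip_onX.
exact: (lip_on_horner _ Aid).
Qed.

End LipschitzOn.

(** * Division of a bivariate polynomial by its content *)

Lemma Bezout_seq (F : fieldType) (s : seq {poly F}) :
  exists (g : {poly F}) (u : nat -> {poly F}),
    g = \sum_(k < size s) u k * s`_k /\ forall k, g %| s`_k.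
Proof.
elim: s => [|p s [g [u [gE gd]]]].
  by exists 0, (fun=> 0); split=> [|k]; rewrite ?big_ord0 // nth_nil dvdp0.
have [[v1 v2] /= vE] := Bezoutp p g.
exists (v1 * p + v2 * g), (fun k => if k is k'.+1 then v2 * u k' else v1); split.
  rewrite big_ord_recl /= {1}gE mulr_sumr; congr (_ + _).
  by apply: eq_bigr => k _; rewrite mulrA.
case=> [|k] /=; first by rewrite (eqp_dvdl _ vE) dvdp_gcdl.
by rewrite (eqp_dvdl _ vE) (dvdp_trans (dvdp_gcdr _ _)).
Qed.

(** The content [g] is the gcd of the coefficients. The Bezout relation is kept because on a bounded
    set it gives, at every point, a coefficient of [P1] that is bounded below uniformly. *)
Lemma poly_coprime_coefs (F : fieldType) (P : {poly {poly F}}) : P != 0 ->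
  exists (g : {poly F}) (P1 : {poly {poly F}}) (u : nat -> {poly F}),
    [/\ g != 0, (size P1 <= size P)%N, P = P1 * g%:P &
        \sum_(k < size P) u k * P1`_k = 1].
Proof.
move=> P0; have [g [u [gE gd]]] := Bezout_seq P.
have g0 : g != 0.
  apply: contraNneq P0 => g0; rewrite -lead_coef_eq0.
  by have := gd (size P).-1; rewrite g0 dvd0p.
pose P1 := \poly_(k < size P) (P`_k %/ g).
have P1E k : P1`_k * g = P`_k.
  rewrite coef_poly; case: ltnP => kP; first by rewrite divpK.
  by rewrite mul0r nth_default.
exists g, P1, u; split=> //; first exact: size_poly.
  by apply/polyP => k; rewrite coefMC P1E.
apply: (mulIf g0); rewrite mul1r [RHS]gE mulr_suml; apply: eq_bigr => k _.
by rewrite -mulrA P1E.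
Qed.

(** * Paths, slabs and exceptional points *)

Lemma lipschitz_within_continuous (R : realType) (A : set R) (f : R -> R) (L : R) :
  (forall x y, A x -> A y -> `|f x - f y| <= L * `|x - y|) ->
  {within A, continuous f}.
Proof.
move=> fL; apply/subspace_continuousP => x Ax; apply/cvgrPdist_lt => e e0.
have L0 : 0 < `|L| + 1 by rewrite ltr_wpDl.
near=> t.
have At : A t by near: t; exact: withinT.
apply: le_lt_trans (fL _ _ Ax At) _.
apply: (@le_lt_trans _ _ ((`|L| + 1) * `|x - t|)).
  by rewrite ler_wpM2r // (le_trans (ler_norm _)) // lerDl.
rewrite mulrC -ltr_pdivlMr //.
near: t; apply: cvg_within.
exact: (nbhsx_ballx x (e / (`|L| + 1)) (divr_gt0 e0 L0)).
Unshelve. all: by end_near. Qed.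

(** Projecting onto the chord gives a real continuous function [G] running from 0 to $D^2$. The
    intermediate value theorem supplies points at the levels $jD^2/n$, and [G] expands distances by
    at most the factor [D]. *)
Lemma path_separated_points (R : realType) (c : R -> R[i]) (L : R) (n : nat) :
  0 <= L ->
  (forall s t, 0 <= s <= 1 -> 0 <= t <= 1 -> cabs (c s - c t) <= L * `|s - t|) ->
  exists t : nat -> R, (forall j, (j <= n)%N -> 0 <= t j <= 1) /\
    forall j k, (j < k <= n)%N ->
      cabs (c 1 - c 0) / n%:R <= cabs (c (t j) - c (t k)).
Proof.
move=> L0 cL; set e := c 1 - c 0; set D := cabs e.
have [D0|Dn0] := eqVneq D 0.
  exists (fun=> 0); split=> [j _|j k _]; first by rewrite lexx ler01.
  by rewrite D0 mul0r cabs_ge0.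
have Dp : 0 < D by rewrite lt_def Dn0 cabs_ge0.
pose G s := complex.Re ((c s - c 0) * conjc e).
have GL s t : `|G s - G t| <= cabs (c s - c t) * D.
  rewrite -ReB -mulrBl opprB addrA subrK; apply: le_trans (Re_le_cabs _) _.
  by rewrite cabsM {2}/cabs normcJ.
have G0 : G 0 = 0 by rewrite /G subrr mul0r.
have G1 : G 1 = D ^+ 2.
  by rewrite sqr_cabs /G -/e; case: (e) => x y /=; ring.
have Gc : {within `[0, 1], continuous G}.
  apply: (@lipschitz_within_continuous _ _ _ (L * D)) => s t.
  rewrite /= !in_itv /= => s01 t01; apply: le_trans (GL _ _) _.
  by rewrite mulrAC ler_wpM2r ?cL // ltW.
have pt j : exists t, (j <= n)%N -> 0 <= t <= 1 /\ G t = j%:R / n%:R * D ^+ 2.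
  have [jn|nj] := leqP j n; last by exists 0.
  have [|t t01 Gt] := @IVT _ G 0 1 (j%:R / n%:R * D ^+ 2) ler01 Gc.
    have r01 : 0 <= (j%:R / n%:R : R) <= 1.
      rewrite divr_ge0 //=; case: n jn => [|n] jn; first by rewrite invr0 mulr0.
      by rewrite ler_pdivrMr ?ltr0n // mul1r ler_nat.
    have D2 : 0 <= D ^+ 2 by rewrite sqr_ge0.
    rewrite G0 G1 (min_idPl _) // (max_idPr _) //.
    case/andP: r01 => r0 r1; rewrite mulr_ge0 //=.
    by rewrite -[leRHS]mul1r ler_wpM2r.
  by exists t => _; split=> //; move: t01; rewrite in_itv.
have [t tP] := choice pt; exists t; split=> [j /tP[]//|j k /andP[jk kn]].
have [_ Gj] := tP j (leq_trans (ltnW jk) kn); have [_ Gk] := tP k kn.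
rewrite -(ler_pM2r Dp); apply: le_trans (GL _ _).
rewrite Gj Gk -mulrBl -mulrBl normrM (ger0_norm (sqr_ge0 _)) expr2 mulrA.
rewrite ler_wpM2r ?(ltW Dp) // [leRHS]mulrC ler_wpM2l ?(ltW Dp) // normrM.
rewrite [`|_^-1|]ger0_norm ?invr_ge0 // ler_peMl ?invr_ge0 //.
rewrite distrC -natrB ?(ltnW jk) // ger0_norm ?ler0n // ler1n subn_gt0 //.
Qed.

(** The region on which solutions have Lipschitz bounds; these degenerate as [eta] tends to 0. *)
Definition slab (R : realType) (eta B : R) : set R[i] :=
  [set z | eta <= complex.Im z /\ cabs z <= B].

(** The roots of [g] are isolated, so the identity extends to them by continuity along a vertical
    segment. *)
Lemma lip_on_eq0 (R : realType) (g : {poly R[i]}) (h : R[i] -> R[i]) : g != 0 ->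
  (forall eta B, 0 < eta -> lip_on (slab eta B) h) ->
  (forall z, Cplus z -> g.[z] != 0 -> h z = 0) ->
  forall z, Cplus z -> h z = 0.
Proof.
move=> g0 hL hg z z0; apply/eqP/negPn/negP; rewrite -cabs_gt0 => e0.
have [M [L [_ L0 _ Lb]]] := hL (complex.Im z) (cabs z + 1) z0.
(* At most 1 to remain in the slab, and at most $|h(z)|/(L+1)$ so that [h] cannot reach 0 within
   this distance. *)
pose del := Num.min 1 (cabs (h z) / (L + 1)).
have L1 : 0 < L + 1 by rewrite ltr_wpDl.
have del0 : 0 < del by rewrite lt_min ltr01 divr_gt0.
pose p k : R[i] := z + (0 +i* (del / k.+1%:R)).
pose rs := [seq p k | k <- iota 0 (size g)].
have rs_uniq : uniq rs.
  rewrite map_inj_uniq ?iota_uniq // => j k /addrI [] /(mulfI (lt0r_neq0 del0)).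
  by move=> /invr_inj /eqP; rewrite eqr_nat eqSS => /eqP.
have [k gk] : exists k, g.[p k] != 0.
  have : ~~ all (root g) rs.
    apply/negP => rsr; have := max_poly_roots g0 rsr rs_uniq.
    by rewrite size_map size_iota ltnn.
  by case/allPn => _ /mapP[k _ ->] gk; exists k.
have tau0 : 0 < del / k.+1%:R by rewrite divr_gt0.
have tau1 : del / k.+1%:R <= del by rewrite ler_pdivrMr // ler_peMr ?ler1n // ltW.
have zp : cabs (p k - z) <= del / k.+1%:R.
  rewrite /p addrC addKr (le_trans (cabs_le_ReIm _)) //= normr0 add0r.
  by rewrite ger0_norm // ltW.
have Imp : complex.Im z < complex.Im (p k) by rewrite ImD /= ltrDl.
have Sz : slab (complex.Im z) (cabs z + 1) z by split=> //; rewrite lerDl.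
have Sp : slab (complex.Im z) (cabs z + 1) (p k).
  split; first exact: ltW.
  rewrite -[p k](subrK z) (le_trans (ler_cabsD _ _)) // addrC lerD2l.
  by rewrite (le_trans zp) // (le_trans tau1) // ge_min lexx.
have := Lb z (p k) Sz Sp; rewrite (hg _ (lt_trans z0 Imp) gk) subr0.
apply/negP; rewrite -ltNge cabs_distC.
apply: (@le_lt_trans _ _ (L * del)).
  by rewrite ler_wpM2l // (le_trans zp).
apply: (@lt_le_trans _ _ ((L + 1) * del)); first by rewrite ltr_pM2r // ltrDl.
by rewrite mulrC -ler_pdivlMr // ge_min lexx orbT.
Qed.

(** The constant is fixed before [f], from [P], the interval, [Phi] and [n] alone. The bound 2 on
    the imaginary parts keeps the points in a disc on which the coefficients of [P1] are Lipschitz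
    and never all small. *)
Lemma algebraic_hoelder (R : realType) (P : {poly {poly R[i]}})
    (al be Phi : R) (n : nat) : P != 0 -> (size P <= n.+1)%N -> (0 < n)%N ->
  let I : set R := `[al, be]%classic in
  exists2 C : R, 0 < C & forall f : R[i] -> R[i],
    (forall z, Cplus z -> (map_poly (horner_eval z) P).[f z] = 0) ->
    (forall eta B, 0 < eta -> lip_on (slab eta B) f) ->
    (forall z, Cplus_over I z -> cabs (f z) <= Phi) ->
    forall z1 z2, Cplus_over I z1 -> Cplus_over I z2 ->
      complex.Im z1 <= 2 -> complex.Im z2 <= 2 ->
      cabs (f z1 - f z2) <= C * cabs (z1 - z2) `^ n%:R^-1.
Proof.
move=> P0 Pn n0 I.
have [g [P1 [u [g0 sP1 PE uE]]]] := poly_coprime_coefs P0.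
pose N := size P; pose B := `|al| + `|be| + 2.
have B0 : 0 <= B by rewrite !addr_ge0.
pose Z : set R[i] := [set z | cabs z <= B].
have Zid : lip_on Z id by apply: (lip_on_id B0) => z.
have /fin_all_exists [L LP] (k : 'I_N) : exists L : R, 0 <= L /\ forall z w, Z z -> Z w ->
    cabs ((P1`_k).[z] - (P1`_k).[w]) <= L * cabs (z - w).
  by have [M [L [_ L0 _ Lb]]] := lip_on_horner P1`_k Zid; exists L.
have /fin_all_exists [M MP] (k : 'I_N) : exists M : R, 0 <= M /\ forall z, Z z ->
    cabs (u k).[z] <= M.
  by have [M [L' [M0 _ Mb _]]] := lip_on_horner (u k) Zid; exists M.
(* If all coefficients of [P1] were below [c], the Bezout sum would be below 1. *)
pose c := (\sum_k M k + 1)^-1.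
have c0 : 0 < c by rewrite invr_gt0 ltr_wpDl // sumr_ge0 // => k _; case: (MP k).
have coef_large z : Z z -> exists k, c <= cabs (P1`_k).[z].
  move=> Zz; apply: contrapT => /forallNP small.
  have := congr1 (fun p : {poly R[i]} => cabs p.[z]) uE.
  rewrite horner_sum hornerC cabs1 => /eqP; apply/negP; rewrite lt_eqF //.
  apply: le_lt_trans (ler_cabs_sum _ _ _) _.
  apply: (@le_lt_trans _ _ ((\sum_k M k) * c)).
    rewrite mulr_suml; apply: ler_sum => k _; rewrite hornerM cabsM.
    apply: ler_pM; rewrite ?cabs_ge0 //; first by case: (MP k) => _; exact.
    by have /negP := small k; rewrite -ltNge => /ltW.
  rewrite ltr_pdivrMr; last by rewrite -invr_gt0.
  by rewrite mul1r ltrDl.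
pose Phi1 := `|Phi|.
have [K K0 KP] := @separated_nodes_coef_bound R n Phi1 (normr_ge0 _).
pose Ls := \sum_(k < N) L k * Phi1 ^+ k.
have Ls0 : 0 <= Ls.
  apply: sumr_ge0 => k _; apply: mulr_ge0; first by case: (LP k).
  by rewrite exprn_ge0 // normr_ge0.
(* From $c(D/n)^n\le K L_s|z_1-z_2|$ for the displacement [D]. *)
pose C0 := n%:R ^+ n * (K * Ls / c).
have C00 : 0 <= C0 by rewrite mulr_ge0 ?exprn_ge0 // divr_ge0 ?mulr_ge0 // ltW.
exists (C0 `^ n%:R^-1 + 1) => [|f fP fL fPhi z1 z2 Iz1 Iz2 z1le z2le].
  by rewrite ltr_wpDl // powR_ge0.
(* Dividing by [g] loses the relation at the roots of [g]; continuity restores it. *)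
pose h z := (map_poly (horner_eval z) P1).[f z].
have h0 z : Cplus z -> h z = 0.
  apply: (lip_on_eq0 g0) => [eta B' eta0|{}z z0 gz].
    apply: lip_on_horner2; last exact: fL.
    apply: (@lip_on_id _ _ `|B'|) => // w [_ wB]; exact: le_trans (ler_norm _).
  have := fP z z0; rewrite PE rmorphM /= map_polyC /= hornerM hornerC horner_evalE.
  by move=> /eqP; rewrite mulf_eq0 (negbTE gz) orbF => /eqP.
have stripZ z : Cplus_over I z -> complex.Im z <= 2 -> Z z.
  move=> [Iz Imz] z2'; rewrite /Z /=; apply: le_trans (cabs_le_ReIm _) _.
  apply: lerD; last by rewrite gtr0_norm.
  move: Iz; rewrite /I /= in_itv /= => /andP[h1 h2].
  by rewrite ler_norml; have := ler_norm (- al); have := ler_norm be;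
    rewrite normrN; move: (normr_ge0 al) (normr_ge0 be); lra.
pose zeta (s : R) : R[i] := z1 + s%:C * (z2 - z1).
have zetaP s : 0 <= s <= 1 -> [/\ Cplus_over I (zeta s), complex.Im (zeta s) <= 2 &
    Num.min (complex.Im z1) (complex.Im z2) <= complex.Im (zeta s)].
  move=> /andP[s0 s1]; have RE : complex.Re (zeta s) =
      complex.Re z1 + s * (complex.Re z2 - complex.Re z1).
    by rewrite /zeta; case: (z1) (z2) => x y [x' y'] /=; ring.
  have IE : complex.Im (zeta s) = complex.Im z1 + s * (complex.Im z2 - complex.Im z1).
    by rewrite /zeta; case: (z1) (z2) => x y [x' y'] /=; ring.
  have conv (x y l r : R) : l <= x <= r -> l <= y <= r -> l <= x + s * (y - x) <= r.
    by move=> /andP[? ?] /andP[? ?]; apply/andP; split; nra.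
  have [Iz1' z10] := Iz1; have [Iz2' z20] := Iz2.
  have /andP[m1 m2] : Num.min (complex.Im z1) (complex.Im z2) <= complex.Im (zeta s) <= 2.
    by rewrite IE; apply: conv; rewrite ge_min lexx ?orbT.
  split=> //; split; last first.
    by apply: lt_le_trans m1; rewrite lt_min z10.
  by move: Iz1' Iz2'; rewrite /I /= !in_itv /= RE; exact: conv.
have zetaB s t : zeta s - zeta t = (s - t)%:C * (z2 - z1).
  by rewrite /zeta rmorphB /=; ring.
pose eta := Num.min (complex.Im z1) (complex.Im z2).
have eta0 : 0 < eta by rewrite lt_min; case: Iz1 => _ ->; case: Iz2 => _ ->.
(* [Lf] depends on the heights of [z1] and [z2]; it serves only the continuity of the path and does
   not enter the constant. *)
have [_ [Lf [_ Lf0 _ Lfb]]] := fL eta B eta0.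
have cL s t : 0 <= s <= 1 -> 0 <= t <= 1 ->
    cabs (f (zeta s) - f (zeta t)) <= Lf * cabs (z2 - z1) * `|s - t|.
  move=> /zetaP[Is s2 se] /zetaP[It t2 te].
  apply: le_trans (Lfb _ _ _ _) _.
  - by split=> //; exact: stripZ.
  - by split=> //; exact: stripZ.
  by rewrite zetaB cabsM cabs_real mulrAC mulrA.
have [t [t01 tsep]] := @path_separated_points _ (f \o zeta) _ n
  (mulr_ge0 Lf0 (cabs_ge0 _)) cL.
have zeta0 : zeta 0 = z1 by rewrite /zeta mul0r addr0.
have zeta1 : zeta 1 = z2 by rewrite /zeta mul1r addrC subrK.
move: tsep; rewrite /= zeta0 zeta1 => tsep.
rewrite cabs_distC; set D := cabs _; rewrite -/D in tsep.
have [->|Dn0] := eqVneq D 0; first by rewrite mulr_ge0 ?powR_ge0 // addr_ge0 ?powR_ge0.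
have D0 : 0 < D by rewrite lt_def Dn0 cabs_ge0.
have Zz1 := stripZ _ Iz1 z1le.
have [k ck] := coef_large _ Zz1.
pose q := map_poly (horner_eval z1) P1.
have nR : 0 < n%:R :> R by rewrite ltr0n.
(* The value $f(\zeta(t_j))$ is an exact root at $\zeta(t_j)$; passing to the coefficients at $z_1$
   costs their Lipschitz variation. *)
have qe j : (j <= n)%N -> cabs q.[f (zeta (t j))] <= Ls * cabs (z1 - z2).
  move=> jn; have [It t2 _] := zetaP _ (t01 j jn).
  rewrite -[q.[_]]subr0 -(h0 (zeta (t j))); last by case: It.
  rewrite /h /q.
  have sz z : (size (map_poly (horner_eval z) P1) <= N)%N.
    exact: leq_trans (size_poly _ _) sP1.
  rewrite !(horner_coef_wide _ (sz _)) -sumrB mulr_suml.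
  apply: le_trans (ler_cabs_sum _ _ _) _; apply: ler_sum => i _.
  rewrite !coef_map /= !horner_evalE -mulrBl cabsM cabsX mulrAC.
  apply: ler_pM; rewrite ?cabs_ge0 ?exprn_ge0 ?cabs_ge0 //; last first.
    rewrite lerXn2r ?nnegrE ?cabs_ge0 ?normr_ge0 //.
    by rewrite (le_trans (fPhi _ It)) ?ler_norm.
  have [L0 Lb] := LP i; apply: le_trans (Lb _ _ Zz1 (stripZ _ It t2)) _.
  rewrite ler_wpM2l // -{1}zeta0 zetaB cabsM cabs_real sub0r normrN cabs_distC.
  have /andP[tj0 tj1] := t01 j jn.
  by rewrite ler_piMl ?cabs_ge0 // ger0_norm.
have sq : (size q <= n.+1)%N := leq_trans (size_poly _ _) (leq_trans sP1 Pn).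
have wB j : (j <= n)%N -> cabs (f (zeta (t j))) <= Phi1.
  by move=> jn; have [It _ _] := zetaP _ (t01 j jn); rewrite (le_trans (fPhi _ It)) ?ler_norm.
have := KP q _ _ _ sq (divr_gt0 D0 nR) wB tsep qe k.
rewrite coef_map /= horner_evalE => Kle.
have Dn : D ^+ n <= C0 * cabs (z1 - z2).
  have : c * (D / n%:R) ^+ n <= K * (Ls * cabs (z1 - z2)).
    by apply: le_trans Kle; rewrite ler_wpM2r // exprn_ge0 // divr_ge0 // ltW.
  rewrite expr_div_n mulrC -ler_pdivlMr // ler_pdivrMr ?exprn_gt0 //.
  by move=> /le_trans; apply; rewrite /C0 le_eqVlt; apply/orP; left; apply/eqP; ring.
have -> : D = (D ^+ n) `^ n%:R^-1.
  by rewrite -powR_mulrn ?ltW // -powRrM divff ?gt_eqF // powRr1 // ltW.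
apply: (@le_trans _ _ ((C0 * cabs (z1 - z2)) `^ n%:R^-1)).
  apply: ge0_ler_powR; rewrite ?invr_ge0 ?nnegrE ?(exprn_ge0 _ (ltW D0)) ?(mulr_ge0 C00 (cabs_ge0 _)) //.
by rewrite powRM ?cabs_ge0 // ler_wpM2r ?powR_ge0 // lerDl.
Qed.

(** * Hoelder continuity and comparability for the Dyson equation *)

Lemma cabs_le_euclid_norm (R : realType) (d : nat) (u : 'cV[R[i]]_d) (i : 'I_d) :
  cabs (u i 0) <= euclid_norm u.
Proof.
rewrite -[leLHS]ger0_norm ?cabs_ge0 // -sqrtr_sqr ler_wsqrtr //.
by rewrite (bigD1 i) //= lerDl sumr_ge0 // => j _; rewrite sqr_ge0.
Qed.

Lemma dyson_lip_on (R : realType) (d : nat) (S : 'M[R]_d) (a : 'cV[R]_d)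
    (m : R[i] -> 'cV[R[i]]_d) :
  (forall i j, 0 <= S i j) -> (forall z, Cplus z -> dyson_solution S a z (m z)) ->
  forall i eta B, 0 < eta -> lip_on (slab eta B) (fun z => m z i 0).
Proof.
move=> S0 ms i eta B eta0.
have pos z : slab eta B z -> 0 < complex.Im z by case=> h _; apply: lt_le_trans h.
exists eta^-1, (eta ^+ 2)^-1; split; rewrite ?invr_ge0 ?exprn_ge0 ?ltW // => z.
  move=> Az; rewrite (le_trans (dyson_le_inv S0 (pos _ Az) (ms _ (pos _ Az)) i)) //.
  by case: (Az) => h _; rewrite lef_pV2 // posrE (pos _ Az).
move=> w Az Aw.
apply: le_trans (dyson_dist S0 (pos _ Az) (pos _ Aw) (ms _ (pos _ Az)) (ms _ (pos _ Aw)) i) _.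
rewrite mulrC ler_wpM2r ?cabs_ge0 // lef_pV2 ?posrE ?mulr_gt0 ?exprn_gt0 ?pos //.
by case: (Az) => hz _; case: (Aw) => hw _; rewrite expr2 ler_pM // ltW.
Qed.

(** Three regimes: distant points use the bound [Phi], low points the algebraic relation, and close
    points at height at least 1 the Lipschitz estimate [dyson_dist]. *)
Lemma dyson_hoelder (R : realType) (d : nat) (S : 'M[R]_d) (a : 'cV[R]_d)
    (al be Phi : R) : (forall i j, 0 <= S i j) ->
  let I : set R := `[al, be]%classic in
  exists C alpha : R, [/\ 0 < C, 0 < alpha, alpha <= 1 &
    forall m : R[i] -> 'cV[R[i]]_d,
    (forall z, Cplus z -> dyson_solution S a z (m z)) ->
    (forall z, Cplus_over I z -> euclid_norm (m z) <= Phi) ->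
    forall i z1 z2, Cplus_over I z1 -> Cplus_over I z2 ->
      cabs (m z1 i 0 - m z2 i 0) <= C * cabs (z1 - z2) `^ alpha].
Proof.
move=> S0 I.
have /fin_all_exists [Q QP] (i : 'I_d) : exists Q : {poly {poly R[i]}}, Q != 0 /\
    forall z u, Cplus z -> dyson_solution S a z u ->
    (map_poly (horner_eval z) Q).[u i 0] = 0.
  have [Q Q0 Qr] := dyson_algebraic (fun i j => (S i j)%:C) (fun i => (a i 0)%:C) i.
  exists Q; split=> // z u z0 us; apply: (Qr z (fun j => u j 0)).
    by move=> j; rewrite /dyson_form (dyson_prodE us) addNr.
  exact: dyson_jacobian_inj z0 us.
(* A common degree bound, so that all components share one exponent; the successor makes it
   positive. *)
pose n := (\sum_i size (Q i)).+1.
have Qn i : (size (Q i) <= n.+1)%N.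
  by rewrite ltnW // ltnW // !ltnS (bigD1 i) //= leq_addr.
have /fin_all_exists [C CP] (i : 'I_d) : exists C : R, 0 < C /\ forall f : R[i] -> R[i],
    (forall z, Cplus z -> (map_poly (horner_eval z) (Q i)).[f z] = 0) ->
    (forall eta B, 0 < eta -> lip_on (slab eta B) f) ->
    (forall z, Cplus_over I z -> cabs (f z) <= Phi) ->
    forall z1 z2, Cplus_over I z1 -> Cplus_over I z2 ->
      complex.Im z1 <= 2 -> complex.Im z2 <= 2 ->
      cabs (f z1 - f z2) <= C * cabs (z1 - z2) `^ n%:R^-1.
  have [C C0 CP] := algebraic_hoelder al be Phi (QP i).1 (Qn i) isT.
  by exists C.
pose alpha : R := n%:R^-1.
have alpha0 : 0 < alpha by rewrite invr_gt0 ltr0n.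
have alpha1 : alpha <= 1 by rewrite invf_le1 ?ler1n ?ltr0n.
have SC0 : 0 <= \sum_i C i by apply: sumr_ge0 => i _; case: (CP i) => /ltW.
exists (\sum_i C i + `|Phi| * 2 + 1), alpha; split=> //.
  by rewrite ltr_wpDl // addr_ge0 // mulr_ge0.
move=> m ms mPhi i z1 z2 Iz1 Iz2.
set X := cabs (z1 - z2) `^ alpha; have X0 : 0 <= X by exact: powR_ge0.
have [z10 z20] : 0 < complex.Im z1 /\ 0 < complex.Im z2 by case: Iz1 Iz2 => _ + [_ +].
have mb z : Cplus_over I z -> cabs (m z i 0) <= `|Phi|.
  move=> Iz; rewrite (le_trans (cabs_le_euclid_norm _ _)) //.
  by rewrite (le_trans (mPhi _ Iz)) // ler_norm.
rewrite !mulrDl mul1r.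
have PX : 0 <= `|Phi| * 2 * X by rewrite !mulr_ge0.
have SX : 0 <= (\sum_i C i) * X by rewrite mulr_ge0.
have [far|near] := leP 1 (cabs (z1 - z2)).
  have X1 : 1 <= X by rewrite -(powRr0 (cabs (z1 - z2))) ler_powR // ltW.
  have : cabs (m z1 i 0 - m z2 i 0) <= `|Phi| * 2 * X.
    apply: (@le_trans _ _ (`|Phi| * 2)); last by rewrite ler_peMr // mulr_ge0.
    by rewrite (le_trans (ler_cabsB _ _)) // mulr_natr mulr2n lerD ?mb.
  lra.
have dX : cabs (z1 - z2) <= X.
  have [->|zn] := eqVneq (cabs (z1 - z2)) 0; first exact: powR_ge0.
  by rewrite ger1_powR // lt_def zn cabs_ge0 /= ltW.
have [low|high] := boolP ((complex.Im z1 <= 2) && (complex.Im z2 <= 2)).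
  have /andP[l1 l2] := low; have [Ci0 Ci] := CP i.
  have : cabs (m z1 i 0 - m z2 i 0) <= C i * X.
    apply: (Ci (fun z => m z i 0)) => //.
    - by move=> z z0; apply: (QP i).2 => //; exact: ms.
    - exact: (dyson_lip_on S0 ms i).
    - move=> z Iz; exact: le_trans (cabs_le_euclid_norm _ _) (mPhi _ Iz).
  have : C i * X <= (\sum_i C i) * X.
    rewrite ler_wpM2r // (bigD1 i) //= lerDl sumr_ge0 // => j _.
    by case: (CP j) => /ltW.
  lra.
have Imd := le_lt_trans (Im_le_cabs (z1 - z2)) near.
(* At distance below 1 with one height above 2, both heights are at least 1. *)
have [h1 h2] : 1 <= complex.Im z1 /\ 1 <= complex.Im z2.
  move: Imd high; rewrite ImB ltr_norml negb_and -!ltNge => /andP[? ?] /orP[] ?; split; lra.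
have : cabs (m z1 i 0 - m z2 i 0) <= X.
  apply: le_trans (dyson_dist S0 z10 z20 (ms _ z10) (ms _ z20) i) _.
  apply: le_trans dX; rewrite ler_pdivrMr ?mulr_gt0 // ler_peMr ?cabs_ge0 //.
  by rewrite -[1]mulr1 ler_pM.
lra.
Qed.

(** With $v=\operatorname{Im}u$, the lower bound $1\le K|u_k|$ turns the identity for imaginary
    parts into $Sv\le K^2v$. Iteration gives $S^pv\le K^{2p}v$, and irreducibility supplies a power
    with a positive entry for each pair of indices. *)
Lemma dyson_Im_comparable (R : realType) (d : nat) (S : 'M[R]_d) (a : 'cV[R]_d)
    (al be Phi : R) : (forall i j, 0 <= S i j) -> irreducible_mx S ->
  let I : set R := `[al, be]%classic in
  exists2 C : R, 0 < C & forall z u,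
    Cplus_over I z -> complex.Im z <= 1 -> dyson_solution S a z u ->
    euclid_norm u <= Phi ->
    forall i j, complex.Im (u i 0) <= C * complex.Im (u j 0).
Proof.
move=> S0 Sirr I.
have /choice [n nP] (ij : 'I_d * 'I_d) : exists n, 0 < (S ^+ n) ij.1 ij.2.
  by have [n _ h] := Sirr ij.1 ij.2; exists n.
(* [K] bounds the cofactor in [dyson_ge] uniformly over the part of the strip up to height 1. *)
pose K := `|al| + `|be| + 1 + \sum_i `|a i 0| + (\sum_i \sum_j S i j) * `|Phi|.
have K0 : 0 <= K.
  by rewrite !addr_ge0 ?mulr_ge0 ?sumr_ge0 // => i _; rewrite sumr_ge0.
pose C := \sum_ij K ^+ (2 * n ij) / (S ^+ n ij) ij.1 ij.2.
have term0 ij : 0 <= K ^+ (2 * n ij) / (S ^+ n ij) ij.1 ij.2.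
  by rewrite divr_ge0 ?exprn_ge0 // ltW.
exists (C + 1) => [|z u [Iz z0] z1 us uPhi i j].
  by rewrite ltr_wpDl // sumr_ge0.
have v0 := dyson_Im_gt0 us.
have uK k : 1 <= cabs (u k 0) * K.
  have : forall k, cabs (u k 0) <= `|Phi|.
    by move=> k'; rewrite (le_trans (cabs_le_euclid_norm _ _)) // (le_trans uPhi) // ler_norm.
  move=> /(dyson_ge S0 us)/(_ k)/le_trans; apply.
  rewrite ler_wpM2l ?cabs_ge0 //; apply: lerD; first apply: lerD.
  - apply: le_trans (cabs_le_ReIm _) _; apply: lerD; last by rewrite gtr0_norm.
    move: Iz; rewrite /I /= in_itv /= => /andP[h1 h2].
    by rewrite ler_norml; have := ler_norm (- al); have := ler_norm be;
      rewrite normrN; move: (normr_ge0 al) (normr_ge0 be); lra.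
  - by rewrite (bigD1 k) //= lerDl sumr_ge0.
  - rewrite ler_wpM2r // [leRHS](bigD1 k) //= lerDl sumr_ge0 // => l _.
    by rewrite sumr_ge0.
pose v : 'cV[R]_d := \col_k complex.Im (u k 0).
have step k : (S *m v) k 0 <= K ^+ 2 * complex.Im (u k 0).
  rewrite mxE (eq_bigr (fun l => S k l * complex.Im (u l 0))); last first.
    by move=> l _; rewrite mxE.
  rewrite (dyson_ImE us k) mulrA -exprMn [K * _]mulrC.
  have X0 : 0 <= \sum_l S k l * complex.Im (u l 0).
    by apply: sumr_ge0 => l _; rewrite mulr_ge0 // ltW.
  apply: (@le_trans _ _ (complex.Im z + \sum_l S k l * complex.Im (u l 0))).
    by rewrite lerDr ltW.
  by rewrite ler_peMl ?addr_ge0 ?(ltW z0) // expr_ge1 // (le_trans _ (uK k)).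
have steps p k : (S ^+ p *m v) k 0 <= K ^+ (2 * p) * complex.Im (u k 0).
  elim: p k => [|p IH] k; first by rewrite !expr0 mul1mx mul1r mxE.
  rewrite exprS -mulmxA mxE.
  apply: (@le_trans _ _ (\sum_l S k l * (K ^+ (2 * p) * complex.Im (u l 0)))).
    by apply: ler_sum => l _; rewrite ler_wpM2l.
  rewrite mulnS addnC exprD -mulrA; apply: le_trans (ler_wpM2l (exprn_ge0 _ K0) (step k)).
  rewrite mxE mulr_sumr le_eqVlt; apply/orP; left; apply/eqP.
  by apply: eq_bigr => l _; rewrite mxE mulrCA.
have Sp0 p k l : 0 <= (S ^+ p) k l.
  elim: p k l => [|p IH] k l; first by rewrite expr0 mxE ler0n.
  by rewrite exprS mxE sumr_ge0 // => r _; rewrite mulr_ge0.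
have := steps (n (j, i)) j; rewrite mxE (bigD1 i) //= mxE => h.
have {h} h : (S ^+ n (j, i)) j i * complex.Im (u i 0) <=
    K ^+ (2 * n (j, i)) * complex.Im (u j 0).
  apply: le_trans h; rewrite lerDl sumr_ge0 // => l _; rewrite mxE mulr_ge0 //.
  exact: ltW.
have Sji := nP (j, i); rewrite /= in Sji.
apply: (@le_trans _ _ (K ^+ (2 * n (j, i)) / (S ^+ n (j, i)) j i * complex.Im (u j 0))).
  by rewrite mulrAC ler_pdivlMr // mulrC.
rewrite ler_wpM2r ?(ltW (v0 j)) // /C (bigD1 (j, i)) //= -addrA lerDl addr_ge0 //.
by rewrite sumr_ge0.
Qed.

(** * Boundary values *)

Definition hoelder_on (R : realType) (A : set R[i]) (C alpha : R)
    (f : R[i] -> R[i]) : Prop :=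
  forall z w, A z -> A w -> cabs (f z - f w) <= C * cabs (z - w) `^ alpha.

Section BoundaryValues.
Variables (R : realType) (I : set R) (f : R[i] -> R[i]) (C alpha : R).
Hypotheses (C0 : 0 < C) (alpha0 : 0 < alpha) (alpha1 : alpha <= 1).
Hypothesis fH : hoelder_on (Cplus_over I) C alpha f.

Lemma cabs_vertical (x s t : R) : cabs ((x +i* s) - (x +i* t)) = `|s - t|.
Proof.
have -> : (x +i* s) - (x +i* t) = 0 +i* (s - t) by congr Complex; rewrite subrr.
by rewrite /cabs normc_def /= expr0n /= add0r sqrtr_sqr.
Qed.

Let fv x eta := f (x +i* eta).

Let fv_dist x s t : I x -> 0 < s -> 0 < t ->
  cabs (fv x s - fv x t) <= C * `|s - t| `^ alpha.
Proof.
move=> Ix s0 t0; apply: le_trans (fH _ _) _; rewrite ?cabs_vertical //.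
Qed.

Let small e : 0 < e -> exists2 r : R, 0 < r & C * r `^ alpha < e.
Proof.
move=> e0; exists ((e / (C * 2)) `^ alpha^-1).
  by rewrite powR_gt0 // divr_gt0 // mulr_gt0.
rewrite -powRrM mulVf ?gt_eqF // powRr1; last by rewrite divr_ge0 ?mulr_ge0 // ltW.
have -> : C * (e / (C * 2)) = e / 2 by field; rewrite gt_eqF.
by rewrite ltr_pdivrMr // ltr_pMr // ltr1n.
Qed.

(** The Hoelder bound makes [g] Cauchy at 0 and survives the passage to the limit. *)
Lemma at_right_cauchy (g : R -> R) :
  (forall s t, 0 < s -> 0 < t -> `|g s - g t| <= C * `|s - t| `^ alpha) ->
  exists l, g eta @[eta --> 0^'+] --> l /\
    forall s, 0 < s -> `|g s - l| <= C * s `^ alpha.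
Proof.
move=> gH.
have /cvg_ex [/= l gl] : cvg (g eta @[eta --> 0^'+]).
  apply/cauchy_cvgP; apply: cauchy_exP => e e0.
  have [r r0 re] := small e0.
  exists (g r); change (\forall s \near 0^'+, ball (g r) e (g s)).
  near=> s; rewrite /ball /=.
  have s0 : 0 < s by near: s; exact: nbhs_right_gt.
  apply: le_lt_trans (gH _ _ r0 s0) _; apply: le_lt_trans re.
  rewrite ler_wpM2l ?(ltW C0) // ge0_ler_powR ?nnegrE ?(ltW alpha0) ?(ltW r0) //.
  have sr : s <= r by near: s; exact: nbhs_right_ltW.
  by rewrite ger0_norm ?subr_ge0 // gerBl ltW.
exists l; split=> // s s0.
have cl : `|g s - g eta| @[eta --> 0^'+] --> `|g s - l|.
  by apply: cvg_norm; apply: cvgB gl; exact: cvg_cst.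
have bound : \forall eta \near 0^'+, `|g s - g eta| <= C * s `^ alpha.
  near=> eta; have eta0 : 0 < eta by near: eta; exact: nbhs_right_gt.
  apply: le_trans (gH _ _ s0 eta0) _.
  rewrite ler_wpM2l ?(ltW C0) // ge0_ler_powR ?nnegrE ?(ltW alpha0) ?(ltW s0) //.
  have sr : eta <= s by near: eta; exact: nbhs_right_ltW.
  by rewrite ger0_norm ?subr_ge0 // gerBl ltW.
exact: (cvgr_to_le cl bound).
Unshelve. all: by end_near. Qed.

(** The limit is taken vertically, in real and imaginary part separately, hence the factor 2. A
    general [z] is first compared with the point above [x] at height $r=|z-x|$. *)
Lemma boundary_value x : I x -> exists l : R[i],
  [/\ complex.Im (fv x eta) @[eta --> 0^'+] --> complex.Im l,
      forall s, 0 < s -> cabs (fv x s - l) <= 2 * C * s `^ alpha &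
      forall z, Cplus_over I z -> cabs (f z - l) <= 4 * C * cabs (z - x%:C) `^ alpha].
Proof.
move=> Ix.
have [lr [_ lrP]] := @at_right_cauchy (fun s => complex.Re (fv x s))
  (fun s t s0 t0 => le_trans (eq_ind _ (fun y => `|y| <= _) (Re_le_cabs _) _ (ReB _ _)) (fv_dist Ix s0 t0)).
have [li [liC liP]] := @at_right_cauchy (fun s => complex.Im (fv x s))
  (fun s t s0 t0 => le_trans (eq_ind _ (fun y => `|y| <= _) (Im_le_cabs _) _ (ImB _ _)) (fv_dist Ix s0 t0)).
exists (lr +i* li).
have close s : 0 < s -> cabs (fv x s - (lr +i* li)) <= 2 * C * s `^ alpha.
  move=> s0; apply: le_trans (cabs_le_ReIm _) _; rewrite ReB ImB /=.
  by rewrite -mulrA mulr_natl mulr2n lerD ?lrP ?liP.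
split=> // z Iz.
set r := cabs (z - x%:C).
have r0 : 0 < r.
  rewrite cabs_gt0 subr_eq0; apply: contraTneq (Iz.2) => ->.
  by rewrite /= ltxx.
apply: le_trans (ler_cabs_dist (fv x r) _ _) _.
(* [z] is within $2r$ of that point, and $(2r)^\alpha\le 2r^\alpha$ as $\alpha\le 1$. *)
have -> : 4 * C * r `^ alpha = C * (2 * r `^ alpha) + 2 * C * r `^ alpha by ring.
apply: lerD; last exact: close.
apply: le_trans (fH Iz _) _; first by split.
rewrite ler_wpM2l ?(ltW C0) //.
apply: (@le_trans _ _ ((2 * r) `^ alpha)); last first.
  rewrite powRM ?(ltW r0) // ler_wpM2r ?powR_ge0 //.
  by rewrite -[leRHS](@powRr1 R 2) // ler_powR // ler1n.
rewrite ge0_ler_powR ?nnegrE ?(ltW alpha0) ?cabs_ge0 ?mulr_ge0 ?(ltW r0) //.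
rewrite mulr_natl mulr2n; apply: le_trans (ler_cabs_dist x%:C _ _) _.
rewrite -/r lerD2l.
by have := cabs_vertical x 0 r; rewrite sub0r normrN (gtr0_norm r0) => ->.
Qed.

Lemma extension_boundary x l : I x ->
  (forall z, Cplus_over I z -> cabs (f z - l) <= 4 * C * cabs (z - x%:C) `^ alpha) ->
  extension I f x%:C = l.
Proof.
move=> Ix lP; rewrite /extension /= ltxx.
(* Positive elements of [R[i]] are real, so the radii of balls are real numbers. *)
have pos_real (e : R[i]) : 0 < e -> exists2 r : R, 0 < r & e = r%:C.
  move=> e0; have /complex_realP [r re] := gtr0_real e0.
  by exists r; rewrite // -ltcR -re.
have PF : ProperFilter (within (Cplus_over I) (nbhs (x%:C : R[i]^o))).
  refine (@within_nbhs_proper (R[i]^o : topologicalType) (Cplus_over I) x%:C _).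
  move=> B /nbhs_ballP [e /pos_real [r r0 ->] eB].
  exists (x +i* (r / 2)); split; first by split=> //=; rewrite divr_gt0.
  apply: eB; rewrite /ball /= normc_cabs ltcR cabs_vertical sub0r normrN.
  by rewrite gtr0_norm ?divr_gt0 // ltr_pdivrMr // ltr_pMr // ltr1n.
apply: (@cvg_lim (R[i]^o : ptopologicalType)).
  exact: (@norm_hausdorff R[i] (R[i]^o : normedModType R[i])).
apply/cvgrPdist_lt => e /pos_real [r r0 ->].
have C40 : 0 < 4 * C by rewrite mulr_gt0.
pose h := (r / (4 * C * 2)) `^ alpha^-1.
have h0 : 0 < h by rewrite powR_gt0 // divr_gt0 // mulr_gt0.
have hr : 4 * C * h `^ alpha < r.
  rewrite -powRrM mulVf ?gt_eqF // powRr1; last by rewrite divr_ge0 ?mulr_ge0 // ltW.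
  have -> : 4 * C * (r / (4 * C * 2)) = r / 2 by field; rewrite gt_eqF.
  by rewrite ltr_pdivrMr // ltr_pMr // ltr1n.
near=> w.
have Aw : Cplus_over I w by near: w; exact: withinT.
rewrite -normrN opprB normc_cabs ltcR; apply: le_lt_trans (lP w Aw) _.
apply: le_lt_trans hr; rewrite ler_wpM2l ?(ltW C40) //.
rewrite ge0_ler_powR ?nnegrE ?(ltW alpha0) ?cabs_ge0 ?(ltW h0) //.
rewrite -lecR -normc_cabs -normrN opprB ltW //.
near: w; apply: cvg_within.
by apply: (nbhsx_ballx (x%:C : R[i]^o) h%:C); rewrite ltcR.
Unshelve. all: by end_near. Qed.

End BoundaryValues.

(** * Stieltjes inversion *)

(** The imaginary part of the Cauchy kernel $1/(t-x-i\eta)$, hence $\pi$ times the usual Poisson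
    kernel. *)
Definition poisson_kernel (R : realType) (eta x t : R) : R :=
  eta / ((t - x) ^+ 2 + eta ^+ 2).

Section StieltjesInversion.
Variables (R : realType) (nu : probability (measurableTypeR R) R).
Implicit Types eta x t a b : R.
Local Notation mu := (@lebesgue_measure R).

Lemma poisson_denom_gt0 eta x t : 0 < eta -> 0 < (t - x) ^+ 2 + eta ^+ 2.
Proof. by move=> eta0; rewrite ltr_wpDl ?sqr_ge0 // exprn_gt0. Qed.

Lemma poisson_kernel_ge0 eta x t : 0 < eta -> 0 <= poisson_kernel eta x t.
Proof. by move=> eta0; rewrite divr_ge0 ?ltW // poisson_denom_gt0. Qed.

Lemma poisson_kernel_le eta x t : 0 < eta -> poisson_kernel eta x t <= eta^-1.
Proof.
move=> eta0; rewrite ler_pdivrMr ?poisson_denom_gt0 // mulrDr expr2 expr2 mulKf ?gt_eqF //.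
by rewrite -expr2 lerDr mulr_ge0 ?invr_ge0 ?sqr_ge0 // ltW.
Qed.

Lemma Im_cauchy_kernel eta x t :
  complex.Im (1 / (t%:C - (x +i* eta))) = poisson_kernel eta x t.
Proof.
rewrite mul1r ImV sqr_cabs ReB ImB /= sub0r opprK.
by rewrite /poisson_kernel sqrrN.
Qed.

Lemma measurable_poisson_kernel2 eta : 0 < eta ->
  measurable_fun [set: measurableTypeR R * measurableTypeR R]
    (fun p => poisson_kernel eta p.2 p.1).
Proof.
move=> eta0.
have -> : (fun p : measurableTypeR R * measurableTypeR R => poisson_kernel eta p.2 p.1) =
    (fun p => eta * ((p.1 - p.2) ^+ 2 + eta ^+ 2) `^ (-1)).
  by apply/funext => p; rewrite powR_inv1 // ltW // poisson_denom_gt0.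
apply: measurable_funM; first exact: measurable_cst.
apply: (measurableT_comp (measurable_powR _)).
apply: measurable_funD; last exact: measurable_cst.
apply: measurable_funX; apply: measurable_funB; [exact: measurable_fst|exact: measurable_snd].
Qed.

Lemma measurable_poisson_kernel eta x : 0 < eta ->
  measurable_fun [set: measurableTypeR R] (poisson_kernel eta x).
Proof.
move=> eta0.
by apply: (measurableT_comp (measurable_poisson_kernel2 eta0) (pair2_measurable x)).
Qed.

Lemma integrable_poisson_kernel eta x : 0 < eta ->
  nu.-integrable setT (EFin \o poisson_kernel eta x).
Proof.
move=> eta0; apply: measurable_bounded_integrable => //.
- by rewrite (le_lt_trans (probability_le1 nu measurableT)) ?ltry.
- exact: measurable_poisson_kernel.
exists eta^-1; split; first exact: num_real.
move=> y ey t _ /=; rewrite ger0_norm ?poisson_kernel_ge0 //.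
exact: le_trans (poisson_kernel_le _ _ eta0) (ltW ey).
Qed.

Lemma Im_stieltjesE eta x : 0 < eta ->
  (complex.Im (stieltjes nu (x +i* eta)))%:E =
  (\int[nu]_t (poisson_kernel eta x t)%:E)%E.
Proof.
move=> eta0.
have -> : complex.Im (stieltjes nu (x +i* eta)) = \int[nu]_t poisson_kernel eta x t.
  rewrite -[LHS]/(\int[nu]_t complex.Im (1 / (t%:C - (x +i* eta)))).
  by apply: eq_Rintegral => t _; exact: Im_cauchy_kernel.
by rewrite /Rintegral fineK // integrable_fin_num //; exact: integrable_poisson_kernel.
Qed.

(** The kernel equals $1/\eta$ at $t=x$, so an atom at [x] contributes its mass divided by
    $\eta$. *)
Lemma atom_le_Im_stieltjes eta x : 0 < eta ->
  (nu [set x] <= (eta * complex.Im (stieltjes nu (x +i* eta)))%:E)%E.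
Proof.
move=> eta0; rewrite EFinM Im_stieltjesE //.
have le1 : ((eta^-1)%:E * nu [set x] <= \int[nu]_t (poisson_kernel eta x t)%:E)%E.
  rewrite -integral_cst //.
  apply: (@le_trans _ _ (\int[nu]_(t in [set x]) (poisson_kernel eta x t)%:E)%E).
    apply: ge0_le_integral => //.
    - by move=> t _; rewrite lee_fin invr_ge0 ltW.
    - by apply/measurable_EFinP; apply: measurable_funTS; exact: measurable_poisson_kernel.
    move=> t /= tx; rewrite tx lee_fin /poisson_kernel subrr expr0n /= add0r.
    by rewrite expr2 invfM mulVKf ?gt_eqF.
  apply: ge0_subset_integral => //.
  - by apply/measurable_EFinP; exact: measurable_poisson_kernel.
  - by move=> t _; rewrite lee_fin poisson_kernel_ge0.
apply: le_trans (lee_wpmul2l _ le1); last by rewrite lee_fin ltW.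
by rewrite muleA -EFinM divff ?gt_eqF // mul1e.
Qed.

Lemma integral_poisson_kernel eta t a b : 0 < eta -> a < b ->
  (\int[mu]_(x in `[a, b]) (poisson_kernel eta x t)%:E =
    (atan ((b - t) / eta) - atan ((a - t) / eta))%:E)%E.
Proof.
move=> eta0 ab.
have dF (x : R) : is_derive x 1 (fun x => atan ((x - t) / eta)) (poisson_kernel eta x t).
  have h : is_derive x 1 (fun x : R => (x - t) / eta) eta^-1.
    by apply: is_derive_eq; rewrite scaler0 add0r subr0 [_ *: _]mulr1.
  have := @is_derive1_comp _ (@atan R) (fun x => (x - t) / eta) x _ _ (is_derive1_atan _) h.
  move/is_derive_eq; apply; rewrite /poisson_kernel.
  have -> : t - x = - (x - t) by rewrite opprB.
  rewrite -invfM sqrrN; move: (x - t) => u.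
  have -> : (1 + (u / eta) ^+ 2) * eta = (u ^+ 2 + eta ^+ 2) / eta.
    by field; rewrite gt_eqF.
  by rewrite invfM invrK mulrC.
have cF (x : R) : {for x, continuous (fun x => atan ((x - t) / eta))}.
  by apply: differentiable_continuous; apply/derivable1_diffP; exact: ex_derive.
rewrite (@continuous_FTC2 _ _ (fun x => atan ((x - t) / eta))) //.
- apply: continuous_subspaceT => x; rewrite /poisson_kernel.
  apply: cvgM; first exact: cvg_cst.
  apply: cvgV; first by rewrite gt_eqF // poisson_denom_gt0.
  have c1 : (t - y) @[y --> x] --> (t - x) by apply: cvgB; [exact: cvg_cst|exact: cvg_id].
  apply: cvgD; last exact: cvg_cst.
  by under [X in X @ _ --> _]funext => y do rewrite expr2; rewrite expr2; exact: cvgM.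
- split.
  + by move=> x _; exact: ex_derive.
  + by apply: cvg_at_right_filter; exact: cF.
  + by apply: cvg_at_left_filter; exact: cF.
- by move=> x _; rewrite derive1E derive_val.
Qed.

(** Tonelli for the kernel, which is symmetric in [x] and [t]; the indicator of the segment is put
    into the integrand so that both integrals run over the whole line. *)
Lemma integral_Im_stieltjes eta a b : 0 < eta -> a < b ->
  (\int[mu]_(x in `[a, b]) (complex.Im (stieltjes nu (x +i* eta)))%:E =
   \int[nu]_t (atan ((b - t) / eta) - atan ((a - t) / eta))%:E)%E.
Proof.
move=> eta0 ab.
pose f (p : measurableTypeR R * measurableTypeR R) :=
  (poisson_kernel eta p.1 p.2 * \1_(`[a, b]%classic : set R) p.1)%:E.
have mf : measurable_fun setT f.
  apply/measurable_EFinP; apply: measurable_funM.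
    rewrite [X in measurable_fun _ X](_ : _ = fun p => poisson_kernel eta p.2 p.1).
      exact: measurable_poisson_kernel2.
    by apply/funext => p; rewrite /poisson_kernel -opprB sqrrN.
  apply: (measurableT_comp _ measurable_fst).
  by apply: measurable_indic; exact: measurable_itv.
have f0 p : (0 <= f p)%E by rewrite lee_fin mulr_ge0 // poisson_kernel_ge0.
have := fubini_tonelli (m1 := mu) (m2 := nu) f mf f0; rewrite /f /=.
under eq_integral => x _.
  have -> : (\int[nu]_y (poisson_kernel eta x y * \1_`[a, b] x)%:E =
     ((fun x => (complex.Im (stieltjes nu (x +i* eta)))%:E) \_ `[a, b]) x)%E.
    rewrite patchE indicE; case: ifPn => xab.
      under eq_integral => y _ do rewrite mulr1.
      by rewrite Im_stieltjesE.
    by apply: integral0_eq => y _; rewrite mulr0.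
  over.
rewrite -integral_mkcond => ->; apply: eq_integral => t _.
rewrite -integral_poisson_kernel // [RHS]integral_mkcond; apply: eq_integral => x _.
by rewrite patchE indicE; case: ifPn => xab; rewrite ?mulr1 ?mulr0.
Qed.

Lemma cvg_atan_natmul (c : R) : c != 0 ->
  atan (c * n.+1%:R) @[n --> \oo] --> (if 0 < c then pi / 2 else - (pi / 2)).
Proof.
have pos (e : R) : 0 < e -> atan (e * n.+1%:R) @[n --> \oo] --> pi / 2.
  move=> e0; apply: (@cvg_comp _ _ _ (fun n => e * n.+1%:R) (@atan R) _ (pinfty_nbhs R)).
    apply/cvgryPge => A; near=> n; rewrite -ler_pdivrMl //.
    by apply: (@le_trans _ _ n%:R); [near: n; exact: nbhs_infty_ger|rewrite ler_nat].
  exact: cvgy_atan.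
move=> c0; case: ifPn => [|]; first exact: pos.
rewrite -leNgt le_eqVlt (negbTE c0) /= => cneg.
have -> : (fun n => atan (c * n.+1%:R)) = (fun n => - atan (- c * n.+1%:R)).
  by apply/funext => n; rewrite mulNr atanN opprK.
by apply: cvgN; apply: pos; rewrite oppr_gt0.
Unshelve. all: by end_near. Qed.

(** Dominated convergence with the constant $\pi$: the integrand tends to $\pi$ inside the segment
    and to 0 outside. At an endpoint the limit is $\pi/2$, whence the assumption that endpoints
    carry no mass. *)
Lemma cvg_integral_atan a b : a < b -> nu [set a] = 0%E -> nu [set b] = 0%E ->
  (\int[nu]_t (atan ((b - t) * n.+1%:R) - atan ((a - t) * n.+1%:R))%:E)%E
    @[n --> \oo] --> (pi%:E * nu `[a, b]%classic)%E.
Proof.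
move=> ab nua nub.
have mab : measurable (`[a, b]%classic : set (measurableTypeR R)) by exact: measurable_itv.
have -> : (pi%:E * nu `[a, b]%classic = \int[nu]_t (pi * \1_(`[a, b]%classic) t)%:E)%E.
  rewrite -[in LHS](setIT `[a, b]%classic) -integral_indic // -ge0_integralZl //.
  - by apply/measurable_EFinP; exact: measurable_indic.
  - by rewrite lee_fin pi_ge0.
have matan : measurable_fun setT (@atan R).
  by apply: continuous_measurable_fun; exact: continuous_atan.
have mlin c k : measurable_fun [set: measurableTypeR R] (fun t : R => atan ((c - t) * k)).
  apply: (measurableT_comp matan); apply: measurable_funM; last exact: measurable_cst.
  by apply: measurable_funB; [exact: measurable_cst|exact: measurable_id].
have [] := @dominated_convergence _ _ _ nu setT measurableT
  (fun n t => (atan ((b - t) * n.+1%:R) - atan ((a - t) * n.+1%:R))%:E)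
  (fun t => (pi * \1_(`[a, b]%classic) t)%:E) (cst pi%:E) _ _ _ _ _.
- by move=> n; apply/measurable_EFinP; apply: measurable_funB; exact: mlin.
- apply/measurable_EFinP; apply: measurable_funM; first exact: measurable_cst.
  exact: measurable_indic.
- exists ([set a] `|` [set b]); split.
  + by apply: measurableU; exact: measurable_set1.
  + by rewrite null_set_setU //; exact: measurable_set1.
  move=> t /= /not_implyP[_ nt]; apply: contrapT => /not_orP[/eqP ta /eqP tb].
  apply: nt; apply: cvg_EFin; first by apply: nearW.
  have -> : pi * \1_`[a, b] t = (if 0 < b - t then pi / 2 else - (pi / 2))
     - (if 0 < a - t then pi / 2 else - (pi / 2)) :> R.
    rewrite indicE !subr_gt0 mem_setE in_itv /=.
    have := ab; case: (ltgtP t a) ta => // ta _; case: (ltgtP t b) tb => // tb _ ab';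
      rewrite /=; lra.
  by apply: cvgB; apply: cvg_atan_natmul; rewrite subr_eq0 eq_sym.
- exact: finite_measure_integrable_cst.
- apply: aeW => t n _ /=; rewrite lee_fin.
  have := atan_ltpi2 ((b - t) * n.+1%:R); have := atan_ltpi2 ((a - t) * n.+1%:R).
  have := atan_gtNpi2 ((b - t) * n.+1%:R); have := atan_gtNpi2 ((a - t) * n.+1%:R).
  by rewrite ler_norml; lra.
by [].
Qed.

(** Both sides of [integral_Im_stieltjes] pass to the limit along $\eta=1/(n+1)$: the left by
    domination with [M], the right by [cvg_integral_atan]. *)
Lemma stieltjes_inversion (W : R -> R) (M a b : R) : a < b ->
  nu [set a] = 0%E -> nu [set b] = 0%E ->
  (forall n, measurable_fun (`[a, b]%classic : set (measurableTypeR R))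
     (fun x => complex.Im (stieltjes nu (x +i* n.+1%:R^-1)))) ->
  (forall x n, x \in `[a, b] ->
     `|complex.Im (stieltjes nu (x +i* n.+1%:R^-1))| <= M) ->
  (forall x, x \in `[a, b] ->
     complex.Im (stieltjes nu (x +i* n.+1%:R^-1)) @[n --> \oo] --> W x) ->
  nu `[a, b]%classic = (\int[mu]_(x in `[a, b]) (pi^-1 * W x)%:E)%E.
Proof.
move=> ab nua nub mF FM FW.
have mab : measurable (`[a, b]%classic : set (measurableTypeR R)) by exact: measurable_itv.
have [|||||iW _ cW] := @dominated_convergence _ _ _ mu `[a, b]%classic mab
  (fun n x => (complex.Im (stieltjes nu (x +i* n.+1%:R^-1)))%:E)
  (fun x => (W x)%:E) (cst M%:E) _ _ _ _ _.

- by move=> n; apply/measurable_EFinP; exact: mF.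
- by apply/measurable_EFinP; apply: (measurable_fun_cvg mF) => x xab; apply: FW.
- by apply: aeW => x xab; apply: cvg_EFin; [exact: nearW|exact: FW].
- apply: (@continuous_compact_integrable _ (cst M) _ (@segment_compact R a b)).
  by apply: continuous_subspaceT => x; exact: cvg_cst.
- by apply: aeW => x n xab; rewrite lee_fin; exact: FM.
have cW' := cvg_integral_atan ab nua nub.
have E : (\int[mu]_(x in `[a, b]) (W x)%:E = pi%:E * nu `[a, b]%classic)%E.
  apply: (cvg_unique _ cW); first exact: ereal_hausdorff.
  rewrite (_ : [sequence _]_n = fun n => (\int[nu]_t
    (atan ((b - t) * n.+1%:R) - atan ((a - t) * n.+1%:R))%:E)%E) //.
  apply/funext => n /=; rewrite integral_Im_stieltjes // ?invr_gt0 //.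
  by rewrite invrK.
under eq_integral => x _ do rewrite EFinM.
rewrite integralZl // E muleA -EFinM mulVf ?mul1e // gt_eqF // pi_gt0 //.
Qed.

End StieltjesInversion.

(** * Measures determined by segments, and densities *)

Lemma segment_measure_unique (R : realType)
    (m1 m2 : {measure set (measurableTypeR R) -> \bar R}) :
  (forall a, m1 [set a] = 0%E) -> (forall a, m2 [set a] = 0%E) ->
  (forall a b, m1 `[a, b]%classic = m2 `[a, b]%classic) ->
  (forall a b, (m1 `[a, b]%classic < +oo)%E) ->
  forall A, measurable A -> m1 A = m2 A.
Proof.
move=> m1a m2a m12 m1oo.
(* In the absence of atoms closed segments may be traded for half-open ones, which are stable under
   intersection and generate the Borel sets. *)
have oc (m : {measure set (measurableTypeR R) -> \bar R}) a b :
    m [set a] = 0%E -> m `]a, b]%classic = m `[a, b]%classic.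
  move=> ma; have mI (i : interval R) : measurable ([set` i] : set (measurableTypeR R)).
    exact: measurable_itv.
  have [ab|ba] := leP a b; last first.
    by rewrite !set_itv_ge // bnd_simp -?leNgt -?ltNge // ltW.
  apply/eqP; rewrite eq_le; apply/andP; split.
    by apply: le_measure; rewrite ?inE //; exact: subset_itv_oc_cc.
  rewrite -(@setU1itv _ _ (BRight b) a false) ?bnd_simp //.
  apply: (@le_trans _ _ (m [set a] + m `]a, b]%classic)%E); last by rewrite ma add0e.
  by apply: measureU2; [exact: measurable_set1|exact: mI].
move=> A mA; apply: (@measure_unique _ R (measurableTypeR R) (@ocitv R)
  (fun k => `](- k%:R), k%:R]%classic)) mA => //.
- exact: ocitvI.
- by move=> k; exact: is_ocitv.
- by rewrite bigcup_itvT.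
- by move=> _ [[a b] _ <-] /=; rewrite !oc.
- by move=> k; rewrite oc.
Qed.

Section DensityMeasure.
Variables (R : realType) (v : measurableTypeR R -> R).
Hypotheses (mv : measurable_fun setT v) (v0 : forall x, 0 <= v x).

Definition density_measure (mv : measurable_fun setT v) (v0 : forall x, 0 <= v x)
    (A : set (measurableTypeR R)) : \bar R :=
  (\int[lebesgue_measure]_(x in A) (v x)%:E)%E.

Local Notation m := (density_measure mv v0).

Let m0 : m set0 = 0%E.
Proof. exact: integral_set0. Qed.

Let m_ge0 A : (0 <= m A)%E.
Proof. by apply: integral_ge0 => x _; rewrite lee_fin. Qed.

Let m_sigma_additive : semi_sigma_additive m.
Proof.
move=> /= F mF tF mUF; rewrite /density_measure; apply: cvg_toP.
  apply: ereal_nondecreasing_is_cvgn => n k nk.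
  apply: lee_sum_nneg_natr => // i _ _; exact: m_ge0.
rewrite ge0_integral_bigcup //=.
- by apply/measurable_EFinP; exact: measurable_funTS.
- by move=> x _; rewrite lee_fin.
Qed.

HB.instance Definition _ := isMeasure.Build _ _ _ m m0 m_ge0 m_sigma_additive.

End DensityMeasure.

(** The restriction of [nu] to [I] and the measure whose density is [v] cut off outside [I] are
    finite on segments, without atoms, and agree on segments. *)
Lemma has_density_on_segment (R : realType) (nu : probability (measurableTypeR R) R)
    (al be : R) (v : R -> R) :
  let I : set R := `[al, be]%classic in
  measurable_fun (I : set (measurableTypeR R)) v -> (forall x, I x -> 0 <= v x) ->
  (forall x, I x -> nu [set x] = 0%E) ->
  (forall a b, al <= a -> a < b -> b <= be ->
     nu `[a, b]%classic = (\int[lebesgue_measure]_(x in `[a, b]) (v x)%:E)%E) ->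
  has_density_on nu I v.
Proof.
move=> I mv v0 nu0 nuE; split=> // A mA AI.
have mI : measurable (I : set (measurableTypeR R)) by exact: measurable_itv.
pose w : measurableTypeR R -> R := v \_ I.
have mw : measurable_fun setT w by apply/(measurable_restrict _ mI measurableT); rewrite setTI.
have w0 x : 0 <= w x.
  by rewrite /w patchE; case: ifPn => // /set_mem; exact: v0.
have -> : nu A = mrestr nu mI A by rewrite /mrestr (setIidl AI).
have -> : (\int[lebesgue_measure]_(x in A) (v x)%:E = density_measure mw w0 A)%E.
  by apply: eq_integral => x /set_mem xA; rewrite /w patchE mem_set //; exact: AI.
move: A mA {AI}; apply: segment_measure_unique => [a|a|a b|a b].
- rewrite /= /mrestr; have [Ia|nIa] := pselect (I a).
    by rewrite setIidl ?nu0 // => _ ->.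
  by rewrite (_ : _ `&` _ = set0) ?measure0 //; apply/seteqP; split=> // x [-> /nIa].
- exact: integral_set1.
- rewrite /= /mrestr /density_measure /w.
  rewrite [RHS](_ : _ = \int[lebesgue_measure]_(x in `[a, b])
      ((fun x => (v x)%:E) \_ I) x)%E; last first.
    by apply: eq_integral => x _; rewrite !patchE; case: ifP.
  rewrite -integral_mkcondr.
  pose a' := Num.max a al; pose b' := Num.min b be.
  have -> : `[a, b]%classic `&` I = `[a', b']%classic.
    apply/seteqP; split=> x /=; rewrite /I /= !in_itv /= ge_max le_min.
      by move=> [/andP[-> ->] /andP[-> ->]].
    by move=> /andP[/andP[-> ->] /andP[-> ->]].
  (* The trace of a segment on [I] is a nondegenerate segment, a point or empty. *)
  have [ab|] := ltP a' b'.
    apply: nuE => //; first by rewrite le_max lexx orbT.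
    by rewrite ge_min lexx orbT.
  rewrite le_eqVlt => /predU1P[ba|ba].
    rewrite ba set_itv1 integral_set1 nu0 // /I /= in_itv /=.
    apply/andP; split; first by rewrite /a' le_max lexx orbT.
    by rewrite -ba /b' ge_min lexx orbT.
  by rewrite set_itv_ge ?measure0 ?integral_set0 // bnd_simp -ltNge.
- apply: (@le_lt_trans _ _ 1%E); last exact: ltry.
  by apply: probability_le1; apply: measurableI => //; exact: measurable_itv.
Qed.

(** * Atoms and the pointwise normalised density *)

Lemma no_atom_of_bounded_stieltjes (R : realType)
    (nu : probability (measurableTypeR R) R) (x M : R) :
  (forall eta, 0 < eta -> complex.Im (stieltjes nu (x +i* eta)) <= M) ->
  nu [set x] = 0%E.
Proof.
move=> ImM; have fin : nu [set x] \is a fin_num by exact: fin_num_measure.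
apply/eqP; rewrite eq_le measure_ge0 andbT -(fineK fin) lee_fin leNgt; apply/negP.
(* At this height the atom inequality would give $r\le\eta(|M|+1)=r/2$. *)
set r := fine _ => r0; pose eta := r / (2 * (`|M| + 1)).
have M1 : 0 < `|M| + 1 by rewrite ltr_wpDl.
have eta0 : 0 < eta by rewrite divr_gt0 // mulr_gt0.
have := atom_le_Im_stieltjes nu x eta0; rewrite -(fineK fin) lee_fin -/r.
apply/negP; rewrite -ltNge; apply: (@le_lt_trans _ _ (eta * (`|M| + 1))).
  rewrite ler_wpM2l ?(ltW eta0) // (le_trans (ImM _ eta0)) //.
  by rewrite (le_trans (ler_norm _)) // lerDl.
have -> : eta * (`|M| + 1) = r / 2 by rewrite /eta; field; rewrite gt_eqF.
by rewrite ltr_pdivrMr // ltr_pMr // ltr1n.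
Qed.

(* If there were infinitely many atoms, the finitely supported sum in [density]
   would be [0] by convention, so finiteness is not an issue here. *)
Lemma cvg_Im_atomic_part (R : realType) (nu : probability (measurableTypeR R) R)
    (x : R) : nu [set x] = 0%E ->
  complex.Im (\sum_(t \in atoms nu) ((fine (nu [set t]))%:C / (t%:C - (x +i* eta))))
    @[eta --> 0^'+] --> 0.
Proof.
move=> nux.
have termE t eta : complex.Im ((fine (nu [set t]))%:C / (t%:C - (x +i* eta))) =
    fine (nu [set t]) * poisson_kernel eta x t.
  by rewrite -[X in _ / X]invrK invrK -[_^-1]mul1r Im_real_mul Im_cauchy_kernel.
have term0 t : atoms nu t -> fine (nu [set t]) * poisson_kernel eta x t
    @[eta --> 0^'+] --> 0.
  move=> nut; have tx : t != x by apply: contraTneq nut => ->; rewrite /atoms /= nux eqxx.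
  rewrite -[X in _ --> X](mulr0 (fine (nu [set t]))); apply: cvgM; first exact: cvg_cst.
  apply: cvg_at_right_filter.
  have c2 : (eta ^+ 2) @[eta --> (0 : R)] --> (0 : R).
    by rewrite -[X in _ --> X](mulr0 0); under eq_fun do rewrite expr2; apply: cvgM; exact: cvg_id.
  have -> : (0 : R) = 0 * ((t - x) ^+ 2 + 0)^-1 by rewrite mul0r.
  apply: cvgM; first by rewrite mul0r; exact: cvg_id.
  apply: cvgV; first by rewrite addr0 sqrf_eq0 subr_eq0.
  by apply: cvgD; [exact: cvg_cst|rewrite mul0r; exact: c2].
have sum0 (r : seq R) : (forall t, t \in r -> atoms nu t) ->
    complex.Im (\sum_(t <- r) ((fine (nu [set t]))%:C / (t%:C - (x +i* eta))))
      @[eta --> 0^'+] --> 0.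
  elim: r => [|t r IH] rA.
    by under eq_fun => eta do rewrite big_nil; exact: cvg_cst.
  under eq_fun => eta do rewrite big_cons ImD termE.
  have {}IH := IH (fun u ur => rA u (mem_behead (s := t :: r) ur)).
  have := cvgD (term0 t (rA t (mem_head _ _))) IH; rewrite addr0.
  by apply.
have [fin|infin] := pselect (finite_set (atoms nu)).
  under eq_fun => eta do rewrite fsbig_finite //.
  by apply: sum0 => t; rewrite in_fset_set // inE.
(* Every summand at an atom is nonzero, the denominator having imaginary part $-\eta$, so the
   support is infinite and the sum takes its default value 0. *)
apply: cvg_near_cst; near=> eta; have eta0 : 0 < eta by near: eta; exact: nbhs_right_gt.
rewrite fsbig_dflt //; apply: sub_infinite_set infin => t nut; split=> //= /eqP.
rewrite mulf_eq0 invr_eq0 => /orP[] /eqP.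
  move=> [] /eqP; rewrite fine_eq0 ?fin_num_measure //; exact/negP.
move=> /(congr1 (@complex.Im R)); rewrite ImB /= sub0r => /eqP.
by rewrite oppr_eq0 gt_eqF.
Unshelve. all: by end_near. Qed.

Lemma density_boundary (R : realType) (nu : probability (measurableTypeR R) R)
    (f : R[i] -> R[i]) (x l : R) : nu [set x] = 0%E ->
  complex.Im (f (x +i* eta)) @[eta --> 0^'+] --> l -> density nu f x = pi^-1 * l.
Proof.
move=> nux fl; rewrite /density; congr (_ * _).
apply: cvg_lim; first exact: Rhausdorff.
under eq_fun => eta do rewrite ImB.
rewrite -[l]subr0; apply: cvgB fl _; exact: cvg_Im_atomic_part.
Qed.

Lemma cvg_harmonic_at_right (R : realType) (g : R -> R) (l : R) :
  g eta @[eta --> 0^'+] --> l -> g n.+1%:R^-1 @[n --> \oo] --> l.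
Proof.
move=> /cvg_at_rightP/(_ (@harmonic R)); apply; split; last exact: cvg_harmonic.
by move=> n; rewrite /harmonic /= invr_gt0.
Qed.

(** * Constants, boundary values and the three claims *)

Theorem theorem2p6 (R : realType) (d : nat) (S : 'M[R]_d) (a : 'cV[R]_d)
    (alpha0 beta0 Phi : R) :
  (1 <= d)%N ->
  entrywise_nonneg S ->
  irreducible_mx S ->
  alpha0 <= beta0 ->
  let I : set R := `[alpha0, beta0]%classic in
  exists C alpha : R, [/\ 0 < C, 0 < alpha &
    forall (m : R[i] -> 'cV[R[i]]_d)
      (nu : 'I_d -> probability (measurableTypeR R) R),
    (forall z, Cplus z -> dyson_solution S a z (m z)) ->
    (forall i z, Cplus z -> m z i 0 = stieltjes (nu i) z) ->
    (forall z, Cplus_over I z -> euclid_norm (m z) <= Phi) ->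
    let v (i : 'I_d) : R -> R := density (nu i) (fun z => m z i 0) in
    let mext (i : 'I_d) : R[i] -> R[i] := extension I (fun z => m z i 0) in
    [/\ (forall i, has_density_on (nu i) I (v i)) /\
        (forall (i j : 'I_d) (tau : R), (i < j)%N -> I tau ->
           v i tau <= C * v j tau /\ v j tau <= C * v i tau),
        (forall (i : 'I_d) (tau1 tau2 : R), I tau1 -> I tau2 ->
           `|v i tau2 - v i tau1| <= C * `|tau2 - tau1| `^ alpha) &
        (forall (i : 'I_d) (z1 z2 : R[i]),
           clCplus_over I z1 -> clCplus_over I z2 ->
           cabs (mext i z1 - mext i z2) <= C * cabs (z1 - z2) `^ alpha)]].
Proof.
move=> _ S0 Sirr ab I.
have [Ch [alpha [Ch0 al0 al1 hoelder]]] := dyson_hoelder a alpha0 beta0 Phi S0.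
have [Cc Cc0 compare] := dyson_Im_comparable a alpha0 beta0 Phi S0 Sirr.
have pi0 : 0 < pi^-1 :> R by rewrite invr_gt0 pi_gt0.
(* The summands serve, in this order, the extended solution, the densities and their
   comparability. *)
pose C := 5 * Ch + pi^-1 * (5 * Ch) + Cc.
have C5 : 0 <= 5 * Ch by rewrite mulr_ge0 // ltW.
have pC5 : 0 <= pi^-1 * (5 * Ch) by rewrite mulr_ge0 // ltW.
have Cge1 : 5 * Ch <= C by rewrite /C -addrA lerDl addr_ge0 // ltW.
have Cge2 : pi^-1 * (5 * Ch) <= C by rewrite /C addrAC lerDr addr_ge0 // ltW.
have Cge3 : Cc <= C by rewrite /C lerDr addr_ge0.
exists C, alpha; split=> //; first by rewrite ltr_wpDl // addr_ge0.
move=> m nu ms mnu mPhi v mext.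
have fH i : hoelder_on (Cplus_over I) Ch alpha (fun z => m z i 0).
  by move=> z w Iz Iw; exact: (hoelder m).
have /choice [l lP] (p : 'I_d * R) : exists l : R[i], I p.2 ->
  [/\ complex.Im (m (p.2 +i* eta) p.1 0) @[eta --> 0^'+] --> complex.Im l,
      forall s, 0 < s -> cabs (m (p.2 +i* s) p.1 0 - l) <= 2 * Ch * s `^ alpha &
      forall z, Cplus_over I z ->
        cabs (m z p.1 0 - l) <= 4 * Ch * cabs (z - p.2%:C) `^ alpha].
  have [Ip|nIp] := pselect (I p.2); last by exists 0.
  by have [l lP] := boundary_value Ch0 al0 al1 (fH p.1) Ip; exists l.
have mb i x s : I x -> 0 < s -> cabs (m (x +i* s) i 0) <= Phi.
  by move=> Ix s0; apply: le_trans (cabs_le_euclid_norm _ _) (mPhi _ _).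
have Imst i x s : 0 < s -> complex.Im (stieltjes (nu i) (x +i* s)) = complex.Im (m (x +i* s) i 0).
  by move=> s0; rewrite mnu.
have noatom i x : I x -> nu i [set x] = 0%E.
  move=> Ix; apply: (@no_atom_of_bounded_stieltjes _ _ _ Phi) => s s0.
  rewrite Imst //; exact: le_trans (le_trans (ler_norm _) (Im_le_cabs _)) (mb i x s Ix s0).
have vE i x : I x -> v i x = pi^-1 * complex.Im (l (i, x)).
  by move=> Ix; apply: density_boundary (noatom i x Ix) _; have [] := lP (i, x) Ix.
have Impos i x s : 0 < s -> 0 < complex.Im (m (x +i* s) i 0).
  by move=> s0; case: (ms (x +i* s) s0 i).
have l_ge0 i x : I x -> 0 <= complex.Im (l (i, x)).
  move=> Ix; have [lc _ _] := lP (i, x) Ix; apply: (cvgr_to_ge lc).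
  by near=> s; apply/ltW/Impos; near: s; exact: nbhs_right_gt.
have l_hoelder i x y : I x -> I y ->
    cabs (l (i, x) - l (i, y)) <= 5 * Ch * `|x - y| `^ alpha.
  move=> Ix Iy; have [->|xy] := eqVneq x y.
    by rewrite subrr cabs0 mulr_ge0 ?powR_ge0.
  (* At height $s=|x-y|$: twice $2C_hs^\alpha$ between the axis and that height, and $C_hs^\alpha$
     across, hence the factor 5. *)
  set s := `|x - y|; have s0 : 0 < s by rewrite normr_gt0 subr_eq0.
  have [_ /(_ s s0) /= lx _] := lP (i, x) Ix; have [_ /(_ s s0) /= ly _] := lP (i, y) Iy.
  have := fH i (x +i* s) (y +i* s) (conj Ix s0) (conj Iy s0); rewrite /=.
  have -> : cabs ((x +i* s) - (y +i* s)) = s.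
    by rewrite /cabs normc_def /= subrr expr0n /= addr0 sqrtr_sqr.
  move: lx; rewrite cabs_distC => lx fxy.
  apply: le_trans (ler_cabs_dist (m (x +i* s) i 0) _ _) _.
  have := ler_cabs_dist (m (y +i* s) i 0) (m (x +i* s) i 0) (l (i, y)).
  lra.
have v_near i x y : I x -> I y -> `|v i x - v i y| <= pi^-1 * (5 * Ch) * `|x - y| `^ alpha.
  move=> Ix Iy; rewrite !vE // -mulrBr normrM (gtr0_norm pi0) -mulrA.
  rewrite ler_wpM2l ?(ltW pi0) // -ImB.
  exact: le_trans (Im_le_cabs _) (l_hoelder _ _ _ Ix Iy).
split.
- split=> [i|i j tau _ Itau]; last first.
    have cmp k1 k2 : v k1 tau <= C * v k2 tau.
      have [l1 _ _] := lP (k1, tau) Itau; have [l2 _ _] := lP (k2, tau) Itau.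
      rewrite !vE // mulrCA ler_wpM2l ?(ltW pi0) // -subr_ge0.
      (* The comparison at heights at most 1 passes to the limit. *)
      have lim : C * complex.Im (m (tau +i* s) k2 0) - complex.Im (m (tau +i* s) k1 0)
          @[s --> 0^'+] --> C * complex.Im (l (k2, tau)) - complex.Im (l (k1, tau)).
        by apply: cvgB; [apply: cvgM; [exact: cvg_cst|exact: l2]|exact: l1].
      apply: (cvgr_to_ge lim).
      near=> s; have s0 : 0 < s by near: s; exact: nbhs_right_gt.
      have s1 : s <= 1 by near: s; exact: nbhs_right_ltW.
      have Its : Cplus_over I (tau +i* s) by split.
      have := compare _ (m (tau +i* s)) Its s1 (ms (tau +i* s) s0) (mPhi _ Its) k1 k2.
      rewrite subr_ge0 => /le_trans; apply.
      by rewrite ler_wpM2r // ltW // Impos.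
    by split.
  (* On each horizontal line the solution is Lipschitz, hence measurable, and measurability carries
     over to the boundary values. *)
  have mline n : measurable_fun (I : set (measurableTypeR R))
      (fun x => complex.Im (m (x +i* n.+1%:R^-1) i 0)).
    apply: subspace_continuous_measurable_fun; first exact: measurable_itv.
    have n0 : 0 < n.+1%:R^-1 :> R by rewrite invr_gt0.
    have [_ [L [_ _ _ Lb]]] := dyson_lip_on S0 ms i (`|alpha0| + `|beta0| + n.+1%:R^-1) n0.
    apply: (@lipschitz_within_continuous _ _ _ L) => x y Ix Iy.
    have slabI w : I w -> slab n.+1%:R^-1 (`|alpha0| + `|beta0| + n.+1%:R^-1) (w +i* n.+1%:R^-1).
      move=> Iw; split=> //=; apply: le_trans (cabs_le_ReIm _) _ => /=.
      rewrite (gtr0_norm n0) lerD2r; move: Iw; rewrite /I /= in_itv /= => /andP[h1 h2].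
      by rewrite ler_norml; have := ler_norm (- alpha0); have := ler_norm beta0;
        rewrite normrN; move: (normr_ge0 alpha0) (normr_ge0 beta0); lra.
    rewrite -ImB; apply: le_trans (Im_le_cabs _) _.
    apply: le_trans (Lb _ _ (slabI _ Ix) (slabI _ Iy)) _.
    by rewrite /cabs normc_def /= subrr expr0n /= addr0 sqrtr_sqr.
  have cline x : I x -> complex.Im (m (x +i* n.+1%:R^-1) i 0) @[n --> \oo] -->
      complex.Im (l (i, x)).
    move=> Ix; have [lx _ _] := lP (i, x) Ix.
    exact: (cvg_harmonic_at_right (g := fun s => complex.Im (m (x +i* s) i 0))).
  apply: has_density_on_segment.
  + have ml : measurable_fun (I : set (measurableTypeR R)) (fun x => complex.Im (l (i, x))).
      exact: measurable_fun_cvg mline cline.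
    apply: eq_measurable_fun (measurable_funM (measurable_cst pi^-1) ml) => x /set_mem Ix.
    by rewrite vE.
  + by move=> x Ix; rewrite vE // mulr_ge0 ?(ltW pi0) ?l_ge0.
  + by move=> x Ix; exact: noatom.
  move=> b c ab' bc cb.
  have subI x : x \in `[b, c] -> I x.
    rewrite /I /= !in_itv /= => /andP[h1 h2]; apply/andP; split; lra.
  rewrite (@stieltjes_inversion _ (nu i) (fun x => complex.Im (l (i, x))) Phi b c bc).
  - by apply: eq_integral => x /set_mem /= xbc; rewrite vE //; exact: subI.
  - by apply/noatom/subI; rewrite in_itv /= lexx ltW.
  - by apply/noatom/subI; rewrite in_itv /= lexx ltW.
  - move=> n; have mst : measurable_fun (I : set (measurableTypeR R))
        (fun x => complex.Im (stieltjes (nu i) (x +i* n.+1%:R^-1))).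
      by apply: eq_measurable_fun (mline n) => x _; rewrite Imst // invr_gt0.
    by apply: measurable_funS mst => [|x /subI //]; exact: measurable_itv.
  - move=> x n /subI Ix; rewrite Imst ?invr_gt0 //.
    by rewrite (le_trans (Im_le_cabs _)) // mb // invr_gt0.
  - move=> x /subI Ix.
    have := cline x Ix; apply: cvg_trans; apply: near_eq_cvg; near=> n.
    by rewrite Imst // invr_gt0.
- move=> i x y Ix Iy; apply: le_trans (v_near i y x Iy Ix) _.
  by rewrite ler_wpM2r ?powR_ge0.
have mextP i z : 0 < complex.Im z -> mext i z = m z i 0.
  by move=> z0; rewrite /mext /extension z0.
have mextB i x : I x -> mext i x%:C = l (i, x).
  move=> Ix; apply: (extension_boundary Ch0 al0 Ix).
  by have [] := lP (i, x) Ix.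
have bdry i z x : Cplus_over I z -> I x ->
    cabs (m z i 0 - l (i, x)) <= 5 * Ch * cabs (z - x%:C) `^ alpha.
  move=> Iz Ix; have [_ _ /(_ z Iz) h] := lP (i, x) Ix; apply: le_trans h _.
  by rewrite ler_wpM2r ?powR_ge0 // ler_wpM2r ?(ltW Ch0) // ler_nat.
move=> i z1 z2 Iz1 Iz2.
apply: (@le_trans _ _ (5 * Ch * cabs (z1 - z2) `^ alpha)); last by rewrite ler_wpM2r ?powR_ge0.
(* A point of the closed strip lies in the open strip or is real, which leaves four cases for a
   pair. *)
have real_or z : clCplus_over I z -> Cplus_over I z \/ exists2 x, I x & z = x%:C.
  case: z => x y [/= Ix]; rewrite le_eqVlt => /predU1P[<-|y0]; first by right; exists x.
  by left.
have [I1|[x1 Ix1 ->]] := real_or _ Iz1; have [I2|[x2 Ix2 ->]] := real_or _ Iz2.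
- rewrite !mextP ?I1.2 ?I2.2 //; apply: le_trans (fH i _ _ I1 I2) _.
  by rewrite ler_wpM2r ?powR_ge0 // ler_peMl ?(ltW Ch0) // ler1n.
- by rewrite mextP ?I1.2 // mextB //; exact: bdry.
- by rewrite (mextP i z2) ?I2.2 // mextB // cabs_distC (cabs_distC _ z2); exact: bdry.
rewrite !mextB // -rmorphB cabs_real; exact: l_hoelder.
Unshelve. all: by end_near. Qed.
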